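(* Let $\phi=\frac{1+\sqrt5}{2}$. Then (1) $\displaystyle\lim_{g\to\infty}\frac{1}{g^2}\mathbb{E}_g[w(S)] = \frac{1}{10\phi}$, and (2) for every fixed $\epsilon>0$, $\displaystyle\lim_{g\to\infty}\mathbb{P}_{g}\left[\left|w(S)-\frac{1}{10\phi} g^2 \right|< \epsilon g^2\right] = 1$.
   Context: A numerical semigroup $S$ is a submonoid of $\mathbb{N}_0$ with finite complement; $\mathcal{H}(S)=\mathbb{N}_0\setminus S$ is its set of gaps and $g=g(S)=|\mathcal{H}(S)|$ its genus. The weight of $S$ is $w(S)=\left(\sum_{x\in\mathcal{H}(S)}x\right)-\frac{g(g+1)}{2}$. $\mathcal{S}_g$ is the finite set of numerical semigroups of genus $g$; $\mathbb{P}_g$ and $\mathbb{E}_g$ denote probability and expectation with respect to the uniform distribution on $\mathcal{S}_g$. *)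

(* Defs.v *)
From HB Require Import structures.
From mathcomp Require Import all_boot all_order all_algebra.
From mathcomp Require Import finmap.
From mathcomp Require Import all_classical all_reals all_analysis.
Set Implicit Arguments. Unset Strict Implicit. Unset Printing Implicit Defensive.
Import Order.TTheory GRing.Theory Num.Theory.
Local Open Scope classical_set_scope.
Local Open Scope ring_scope.
Local Open Scope fset_scope.

Definition is_numerical_semigroup (S : set nat) : Prop :=
  S 0%N /\ (forall x y, S x -> S y -> S (x + y)%N) /\ finite_set (~` S).

(* A numerical semigroup is determined by its (finite) set of gaps H;
   we represent S by H, i.e. S = N_0 \ H. *)
Definition semigroup_of (H : {fset nat}) : set nat := ~` [set` H].

Definition genus (H : {fset nat}) : nat := #|` H|.

Definition NS (g : nat) : set {fset nat} :=
  [set H | is_numerical_semigroup (semigroup_of H) /\ genus H = g].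

Definition weight (R : realType) (H : {fset nat}) : R :=
  (\sum_(x <- H) x)%N%:R - ((genus H * (genus H).+1)%N%:R / 2).

Definition card_NS (R : realType) (g : nat) : R := \sum_(H \in NS g) (1 : R).

Definition Prob_g (R : realType) (g : nat) (A : {fset nat} -> Prop) : R :=
  (\sum_(H \in NS g `&` A) (1 : R)) / card_NS R g.

Definition Exp_g (R : realType) (g : nat) (X : {fset nat} -> R) : R :=
  (\sum_(H \in NS g) X H) / card_NS R g.

Definition golden (R : realType) : R := (1 + Num.sqrt 5) / 2.

(* Main.v *)
(* Put u = 1/phi, so u + u^2 = 1, and count a semigroup of genus g with mass u^g.
   A semigroup of multiplicity m is encoded by its Kunz coordinates k_c >= 1
   (0 < c < m), the number of gaps congruent to c modulo m; they add up to g. The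
   sequences with values in {1, 2} are all realized, which gives at least u^(1-g)
   semigroups of genus g. It remains to show that semigroups whose weight is not
   close to u g^2 / 10 contribute exponentially little.
   If m <= g / 10, this is a direct count. If at most m / P gaps exceed 2m, the
   events k_c >= 2 behave, up to a small exponential factor, like independent ones
   of probability u^2, and Chernoff's bound determines m / g and the sum of the gaps
   up to a small error. If more gaps exceed 2m, then for some constant K the topmost
   interval of K integers with three gaps e - d has few gaps above it. Each of these
   three gaps forces k_c + k_c' to be large whenever c + c' = e - d modulo m, so
   that the coordinates form a 3-regular bipartite system of constraints; Finner's
   inequality (as in Kahn's bound on independent sets of regular graphs) bounds its
   weighted count by C rho^m with rho < 1. Two gaps would not suffice: paths have
   growth rate exactly phi. *)

Require Import Defs.
From HB Require Import structures.
From mathcomp Require Import all_boot all_order all_algebra.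
From mathcomp Require Import finmap.
From mathcomp Require Import all_classical all_reals all_analysis.
From mathcomp Require Import zify ring lra.
Set Implicit Arguments. Unset Strict Implicit. Unset Printing Implicit Defensive.
Import Order.TTheory GRing.Theory Num.Theory numFieldNormedType.Exports.
Local Open Scope classical_set_scope.
Local Open Scope ring_scope.

(** * Finner's inequality *)

(** The limit value reflects the typical Kunz coordinates: 1 with probability u and 2 with
    probability u^2. Their mean is 2 - u, so g is about (2 - u) m, and the gaps sum to about m^2 / 2
    + u^2 (3/2) m^2 = (4 - 3u) m^2 / 2 = (u/10 + 1/2) g^2; subtracting g^2 / 2 leaves u g^2 / 10.
    The obstacle is the coordinates above 2: the sum of u^k over all k >= 1 is 1/u > 1, so treating
    the coordinates as independent would overcount by a factor exponential in m. When m exceeds g /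
    10, the counts therefore fix a level e, keep the mass u for the gaps up to e and give each gap
    above e a mass z instead. For small z the sum over one coordinate grows only by a factor 1 / (1
    - z), at the price z^-r when r gaps lie above e; both losses are affordable as soon as r is a
    small fraction of m. *)

Section Finner.
Variables (R : realType) (V A : finType) (p : V -> A -> R).
Hypothesis p_ge0 : forall v a, 0 <= p v a.
Hypothesis p_sum1 : forall v, \sum_a p v a = 1.

Implicit Types (F : {ffun V -> A} -> R) (x : {ffun V -> A}).

Definition expect F : R := \sum_(x : {ffun V -> A}) (\prod_v p v (x v)) * F x.

Definition update x (i : V) (a : A) : {ffun V -> A} :=
  [ffun v => if v == i then a else x v].

(** Averages over coordinate [i] alone. The result is still a function of the whole of [x], so that
    averages over several coordinates compose without a change of type. *)
Definition expect_at (i : V) F x : R := \sum_a p i a * F (update x i a).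

Definition independent (i : V) F := forall x a, F (update x i a) = F x.

Lemma update_id x i : update x i (x i) = x.
Proof. by apply/ffunP => v; rewrite ffunE; case: eqP => [->|]. Qed.

Lemma update_update x i a b : update (update x i a) i b = update x i b.
Proof. by apply/ffunP => v; rewrite !ffunE; case: eqP. Qed.

Lemma update_comm x i j a b : i != j ->
  update (update x i a) j b = update (update x j b) i a.
Proof.
move=> ij; apply/ffunP => v; rewrite !ffunE.
by have [->|] := eqVneq v j; rewrite // eq_sym (negbTE ij).
Qed.

Lemma prod_update x i a :
  (\prod_v p v (update x i a v)) * p i (x i) = (\prod_v p v (x v)) * p i a.
Proof.
rewrite (bigD1 i)//= [in RHS](bigD1 i)//= ffunE eqxx.
rewrite (eq_bigr (fun v => p v (x v))); last first.
  by move=> v vi; rewrite ffunE (negbTE vi).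
ring.
Qed.

(** Exchanging the fresh value with coordinate [i] is an involution on pairs (configuration, fresh
    value) that preserves their joint weight. *)
Lemma expect_expect_at i F : expect (expect_at i F) = expect F.
Proof.
rewrite /expect /expect_at.
transitivity (\sum_(xa : {ffun V -> A} * A)
   (\prod_v p v (xa.1 v) * p i xa.2) * F (update xa.1 i xa.2)).
  rewrite -(pair_bigA _ (fun x a => (\prod_v p v (x v) * p i a) * F (update x i a)))/=.
  apply: eq_bigr => x _; rewrite mulr_sumr.
  by apply: eq_bigr => a _; rewrite mulrA.
have swapK : involutive (fun xa : {ffun V -> A} * A => (update xa.1 i xa.2, xa.1 i)).
  by move=> [x a] /=; rewrite update_update update_id ffunE eqxx.
rewrite (reindex_inj (inv_inj swapK))/=.
transitivity (\sum_(xa : {ffun V -> A} * A) (\prod_v p v (xa.1 v) * p i xa.2) * F xa.1).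
  by apply: eq_bigr => -[x a] _ /=; rewrite prod_update update_update update_id.
rewrite -(pair_bigA _ (fun x a => (\prod_v p v (x v) * p i a) * F x))/=.
apply: eq_bigr => x _; rewrite -mulr_suml -mulr_sumr p_sum1 mulr1 //.
Qed.

Lemma ler_expect F G : (forall x, F x <= G x) -> expect F <= expect G.
Proof.
move=> FG; apply: ler_sum => x _; apply: ler_wpM2l => //.
by apply: prodr_ge0.
Qed.

Lemma expect_prod (f : V -> A -> R) :
  expect (fun x => \prod_v f v (x v)) = \prod_v \sum_a p v a * f v a.
Proof.
rewrite bigA_distr_bigA/= /expect; apply: eq_bigr => x _.
by rewrite -big_split.
Qed.

Lemma expect_cst c : expect (fun=> c) = c.
Proof.
rewrite /expect -mulr_suml -(bigA_distr_bigA (fun v a => p v a)).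
by rewrite big1 ?mul1r// => v _; rewrite p_sum1.
Qed.

Lemma expectD F G : expect (fun x => F x + G x) = expect F + expect G.
Proof. by rewrite /expect -big_split; apply: eq_bigr => x _ /=; rewrite mulrDr. Qed.

Lemma expectZ c F : expect (fun x => c * F x) = c * expect F.
Proof. by rewrite /expect mulr_sumr; apply: eq_bigr => x _ /=; rewrite mulrCA. Qed.

Lemma expect_at_independent i F x : independent i F -> expect_at i F x = F x.
Proof.
move=> iF; rewrite /expect_at (eq_bigr (fun a => p i a * F x)).
  by rewrite -mulr_suml p_sum1 mul1r.
by move=> a _; rewrite iF.
Qed.

Lemma independent_expect_at i j F :
  independent j F \/ i = j -> independent j (expect_at i F).
Proof.
have [->|ij] := eqVneq i j => [_|[jF|ij']] x a.
- by apply: eq_bigr => b _; rewrite update_update.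
- by apply: eq_bigr => b _; rewrite update_comm 1?eq_sym// jF.
- by rewrite ij' eqxx in ij.
Qed.

Lemma expect_at_gt0 i F x : (forall x, 0 < F x) -> 0 < expect_at i F x.
Proof.
move=> F0; have pF0 a : 0 <= p i a * F (update x i a).
  by rewrite mulr_ge0// ltW.
rewrite lt_def sumr_ge0 ?andbT//; apply/negP => /eqP.
move=> /(psumr_eq0P (fun a _ => pF0 a)) pF.
have := p_sum1 i; rewrite big1 => [/eqP|a _]; first by rewrite eq_sym oner_eq0.
by have /eqP := pF a isT; rewrite mulf_eq0 (gt_eqF (F0 _)) orbF => /eqP.
Qed.

Definition expect_seq (s : seq V) F := foldr expect_at F s.

Lemma expect_expect_seq s F : expect (expect_seq s F) = expect F.
Proof. by elim: s => //= i s IH; rewrite expect_expect_at. Qed.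

Lemma expect_seq_gt0 s F x : (forall x, 0 < F x) -> 0 < expect_seq s F x.
Proof. by move=> F0; elim: s x => //= i s IH x; exact: expect_at_gt0. Qed.

Lemma independent_expect_seq s i F :
  independent i F \/ i \in s -> independent i (expect_seq s F).
Proof.
elim: s => [|j s IH]/=; first by case.
rewrite inE => -[iF|/predU1P[->|iS]]; apply: independent_expect_at; try by right.
  by left; apply: IH; left.
by left; apply: IH; right.
Qed.

Lemma independent_cst F x y : (forall i, independent i F) -> F x = F y.
Proof.
move=> iF; pose z (s : seq V) := [ffun v => if v \in s then y v else x v].
have zE s : F (z s) = F x.
  elim: s => [|i s IH].
    by congr F; apply/ffunP => v; rewrite ffunE.
  rewrite -IH -(iF i (z s) (y i)); congr F.
  by apply/ffunP => v; rewrite !ffunE inE; case: eqP => [->|].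
rewrite -(zE (enum V)); congr F.
by apply/ffunP => v; rewrite ffunE mem_enum.
Qed.

Lemma expect_seq_enum F x : expect_seq (enum V) F x = expect F.
Proof.
rewrite -(expect_expect_seq (enum V)) -[LHS]expect_cst.
apply: eq_bigr => y _; congr (_ * _).
apply: independent_cst => i; apply: independent_expect_seq.
by rewrite mem_enum; right.
Qed.

End Finner.

Section Roots.
Variables (R : realType) (t : nat).
Hypothesis t_gt0 : (0 < t)%N.
Definition nroot (x : R) : R := x `^ (t%:R^-1).

Lemma nroot_ge0 x : 0 <= nroot x.
Proof. exact: powR_ge0. Qed.

Lemma nrootK x : 0 <= x -> nroot x ^+ t = x.
Proof.
move=> x0; rewrite -powR_mulrn ?powR_ge0// -powRrM mulVf ?powRr1//.
by rewrite pnatr_eq0 -lt0n.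
Qed.

Lemma nrootM x y : 0 <= x -> 0 <= y -> nroot (x * y) = nroot x * nroot y.
Proof. by move=> x0 y0; rewrite /nroot powRM. Qed.

Lemma nroot1 : nroot 1 = 1.
Proof. by rewrite /nroot powR1. Qed.

Lemma nrootXn x : 0 <= x -> nroot (x ^+ t) = x.
Proof.
move=> x0; rewrite /nroot -powR_mulrn// -powRrM mulfV ?powRr1//.
by rewrite pnatr_eq0 -lt0n.
Qed.

Lemma ler_nroot x y : 0 <= x -> x <= y -> nroot x <= nroot y.
Proof.
move=> x0 xy; rewrite /nroot; apply: ge0_ler_powR; rewrite ?nnegrE ?invr_ge0//.
exact: le_trans xy.
Qed.

(* Padding with ones turns AM-GM for t numbers into a bound for at most t. *)
Lemma prod_nroot_le (I : finType) (B : {set I}) (x : I -> R) :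
  (#|B| <= t)%N -> (forall i, 0 < x i) ->
  \prod_(i in B) nroot (x i) <= 1 + (\sum_(i in B) (x i - 1)) / t%:R.
Proof.
move=> Bt x0; set M := 1 + _.
have t0 : (0 : R) < t%:R by rewrite ltr0n.
have ME : M = ((t - #|B|)%:R + \sum_(i in B) x i) / t%:R.
  by rewrite /M sumrB sumr_const natrB//; field; rewrite gt_eqF.
have M0 : 0 < M.
  rewrite ME divr_gt0//.
  have [B0|/finset.set0Pn[i iB]] := eqVneq B finset.set0.
    by rewrite B0 cards0 subn0 big_set0 addr0.
  rewrite ltr_wpDl ?ler0n// (bigD1 i)//= ltr_wpDr// sumr_ge0// => j _.
  exact: ltW.
rewrite -(ler_pXn2r t_gt0) ?nnegrE ?(ltW M0) ?prodr_ge0// => [|i _]; last exact: nroot_ge0.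
rewrite -prodrXl (eq_bigr x) => [|i _]; last by rewrite nrootK// ltW.
rewrite -[leRHS]mul1r -ler_pdivrMr ?exprn_gt0//.
have -> : \prod_(i in B) x i / M ^+ t =
    (\prod_(i in B) (x i / M)) * M^-1 ^+ (t - #|B|).
  rewrite big_split/= prodr_const -mulrA -exprD exprVn subnKC//.
(* AM-GM follows from y <= exp (y - 1), applied to each x_i / M and to each padding term 1 / M: the
   exponents add up to 0. *)
have le_exp y : 0 <= y -> y <= expR (y - 1).
  by move=> _; have := expR_ge1Dx (y - 1); rewrite addrC subrK.
apply: (@le_trans _ _ (\prod_(i in B) expR (x i / M - 1) * expR (M^-1 - 1) ^+ (t - #|B|))).
  apply: ler_pM.
  - by apply: prodr_ge0 => i _; rewrite divr_ge0// ltW.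
  - by rewrite exprn_ge0// invr_ge0 ltW.
  - apply: ler_prod => i _; have xM : 0 <= x i / M by rewrite divr_ge0// ltW.
    by rewrite xM le_exp.
  - by apply: lerXn2r; rewrite ?nnegrE ?invr_ge0 ?expR_ge0 ?le_exp ?invr_ge0 ?(ltW M0).
rewrite -expR_sum -expRM_natl -expRD -[leRHS]expR0 ler_expR.
rewrite sumrB sumr_const -mulr_suml.
have -> : \sum_(i in B) x i = M * t%:R - (t - #|B|)%:R.
  by rewrite ME; field; rewrite gt_eqF.
rewrite natrB// le_eqVlt; apply/orP; left; apply/eqP; field.
by rewrite gt_eqF.
Qed.

End Roots.

Section FinnerInequality.
Variables (R : realType) (V A Y : finType) (p : V -> A -> R) (t : nat).
Hypothesis t_gt0 : (0 < t)%N.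
Hypothesis p_ge0 : forall v a, 0 <= p v a.
Hypothesis p_sum1 : forall v, \sum_a p v a = 1.
Variable D : V -> {set Y}.
Hypothesis card_D : forall v, (#|D v| <= t)%N.

(** Hölder's inequality in the single coordinate [i], on which at most [t] factors depend. Divided
    by its average, each of them has mean 1, so the AM-GM bound has expectation 1. *)
Lemma expect_at_prod_nroot (H : Y -> {ffun V -> A} -> R) i x :
  (forall y x, 0 < H y x) ->
  (forall y, y \notin D i -> independent i (H y)) ->
  expect_at p i (fun x => \prod_y nroot t (H y x)) x <=
  \prod_y nroot t (expect_at p i (H y) x).
Proof.
move=> H0 iH; pose B y := expect_at p i (H y) x.
have B0 y : 0 < B y by apply: expect_at_gt0.
pose h y a := H y (update x i a) / B y.
have h0 y a : 0 < h y a by rewrite divr_gt0.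
have hE a : \prod_y nroot t (H y (update x i a)) =
    (\prod_y nroot t (B y)) * \prod_(y in D i) nroot t (h y a).
  rewrite [X in _ * X]big_mkcond -big_split; apply: eq_bigr => y _ /=.
  case: ifPn => yD.
    by rewrite -nrootM ?(ltW (h0 _ _)) ?(ltW (B0 _))// /h mulrC divfK ?gt_eqF.
  by rewrite mulr1 /B (iH _ yD) expect_at_independent//; exact: iH.
rewrite /expect_at (eq_bigr _ (fun a _ => congr1 (fun z => p i a * z) (hE a))).
under eq_bigr do rewrite mulrCA.
rewrite -mulr_sumr -[leRHS]mulr1 ler_wpM2l ?prodr_ge0// => [y _|].
  exact: nroot_ge0.
apply: (@le_trans _ _ (\sum_a p i a * (1 + (\sum_(y in D i) (h y a - 1)) / t%:R))).
  by apply: ler_sum => a _; apply: ler_wpM2l => //; exact: prod_nroot_le.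
under eq_bigr do rewrite mulrDr mulr1.
rewrite big_split/= p_sum1 -[leRHS]addr0 lerD2l le_eqVlt; apply/orP; left; apply/eqP.
under eq_bigr do rewrite mulrA mulr_sumr.
rewrite -mulr_suml exchange_big/= big1 ?mul0r// => y _.
under eq_bigr do rewrite mulrBr mulr1 mulrA.
by rewrite sumrB p_sum1 -mulr_suml divff ?subrr// gt_eqF// B0.
Qed.

(** The coordinates are averaged one at a time, each average moving inside the roots. Averaging
    creates no new dependence, so [card_D] still bounds the number of factors at every later
    step. *)
Lemma finner (H : Y -> {ffun V -> A} -> R) :
  (forall y x, 0 < H y x) ->
  (forall i y, y \notin D i -> independent i (H y)) ->
  expect p (fun x => \prod_y nroot t (H y x)) <= \prod_y nroot t (expect p (H y)).
Proof.
move=> H0 iH.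
have step s : expect p (fun x => \prod_y nroot t (H y x)) <=
    expect p (fun x => \prod_y nroot t (expect_seq p s (H y) x)).
  elim: s => //= i s IH; apply: (le_trans IH).
  rewrite -(expect_expect_at p_sum1 i); apply: ler_expect => // x.
  apply: expect_at_prod_nroot => [y z|y yD]; first exact: expect_seq_gt0.
  by apply: independent_expect_seq; left; exact: iH.
apply: (le_trans (step (enum V))).
under [X in expect p X]eq_fun do under eq_bigr do rewrite (expect_seq_enum p_sum1).
by rewrite expect_cst.
Qed.

End FinnerInequality.

(** * Weighted counts of bipartite constraint systems *)

Section ClassWeights.
Variables (R : realType) (u : R).
Hypotheses (u_sq : u ^+ 2 = 1 - u) (u_lb : 618 / 1000 < u)
  (u_ub : u < 6181 / 10000).

Let u_gt0 : 0 < u. Proof. by move: u_lb; lra. Qed.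

(* The weight of the i-th class: i.+1 stands for the value i.+1, or for all the
   values >= M when i.+1 = M. The last weight is exact for M < 4, where the
   values M and M+1 have total weight u^M + u^(M+1) = u^(M-1); for M = 4 it is
   the infinite sum u^4 + u^5 + ... = u^2. *)
Definition class_weight (M : nat) (i : 'I_4) : R :=
  if (i.+1 < M)%N then u ^+ i.+1 else if i.+1 == M then u ^+ minn M.-1 2 else 0.

Definition class_mass (M : nat) : R := \sum_i class_weight M i.

Definition class_tail (M j : nat) : R :=
  \sum_(i < 4) (j <= i)%N%:R * class_weight M i.

(** The mass left to one end of a constraint when the other end has index [j]: the indices [j] and
    [i] stand for the values [j.+1] and [i.+1], which must add up to at least [M.+1]. *)
Definition class_dual (M j : nat) : R :=
  \sum_(i < 4) (M <= (j + i).+1)%N%:R * class_weight M i.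

Lemma class_weight_ge0 M i : 0 <= class_weight M i.
Proof.
by rewrite /class_weight; case: ifP => _; [|case: ifP => _//]; rewrite exprn_ge0// ltW.
Qed.

Lemma cube_u : u ^+ 3 = 2 * u - 1.
Proof. by rewrite exprS u_sq mulrBr mulr1 -expr2 u_sq; lra. Qed.

Lemma class_mass_ge1 M : (0 < M <= 4)%N -> 1 <= class_mass M <= 2.
Proof.
rewrite /class_mass /class_weight !big_ord_recl big_ord0 /= /bump /=.
case: M => [|[|[|[|[|//]]]]]//= _; rewrite ?expr0 ?expr1 ?cube_u ?u_sq.
all: by move: u_lb u_ub => ? ?; apply/andP; split; lra.
Qed.

Lemma class_mass_gt0 M : (0 < M <= 4)%N -> 0 < class_mass M.
Proof. by move=> /class_mass_ge1 /andP[+ _]; apply: lt_le_trans. Qed.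

(** Divided by [class_mass M ^+ 6], the left side is the expectation of the bound [W_cube] below.
    Since u^2 = 1 - u, cubes of linear forms in u are again linear in u. The worst case is M = 2,
    with value 15 u^6, about 0.836. *)
Lemma star_numeric M : (1 < M <= 4)%N ->
  let w j := class_dual M j ^+ 3 in
  w 0%N * class_mass M ^+ 3 + (w 1%N - w 0%N) * class_tail M 1 ^+ 3
  + (w 2%N - w 1%N) * class_tail M 2 ^+ 3
  + (w 3%N - w 2%N) * class_tail M 3 ^+ 3 <= 84 / 100.
Proof.
have uu : u * u = 1 - u by rewrite -expr2.
have linE a b : (a + b * u) ^+ 3 =
    (a ^+ 3 + 3 * a * b ^+ 2 - b ^+ 3)
    + (3 * a ^+ 2 * b - 3 * a * b ^+ 2 + 2 * b ^+ 3) * u.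
  by have -> : (a + b * u) ^+ 3 = a ^+ 3 + 3 * a ^+ 2 * b * u
    + 3 * a * b ^+ 2 * u ^+ 2 + b ^+ 3 * u ^+ 3; [ring|rewrite cube_u u_sq; ring].
rewrite /= /class_mass /class_tail /class_dual /class_weight !big_ord_recl !big_ord0 /=.
case: M => [|[|[|[|[|//]]]]]//= _.
all: rewrite /bump/= ?addr0 ?mul0r ?mul1r ?add0r ?mulr1 ?mulr0 ?addr0.
all: rewrite ?expr0 ?expr1 ?cube_u ?u_sq.
- have -> : u + u = 0 + 2 * u by ring.
  rewrite !linE; move: u_lb u_ub uu => ? ? ?; lra.
- have -> : u + (1 - u + (1 - u)) = 2 + (-1) * u by ring.
  have -> : 1 - u + (1 - u) = 2 + (-2) * u by ring.
  have -> : 1 - u = 1 + (-1) * u by ring.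
  rewrite !linE; move: u_lb u_ub uu => ? ? ?; lra.
- have -> : u + (1 - u + (2 * u - 1 + (1 - u))) = 1 + 1 * u by ring.
  have -> : 1 - u + (2 * u - 1 + (1 - u)) = 1 + 0 * u by ring.
  have -> : 2 * u - 1 + (1 - u) = 0 + 1 * u by ring.
  have -> : 1 - u = 1 + (-1) * u by ring.
  rewrite !linE; move: u_lb u_ub uu => ? ? ?; lra.
Qed.

Lemma class_dual_ge0 M j : 0 <= class_dual M j.
Proof. by apply: sumr_ge0 => b _; rewrite mulr_ge0 ?class_weight_ge0. Qed.

End ClassWeights.

Section StarBound.
Variables (R : realType) (u : R).
Hypotheses (u_sq : u ^+ 2 = 1 - u) (u_lb : 618 / 1000 < u)
  (u_ub : u < 6181 / 10000).
Local Notation weight_of := (class_weight u).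
Local Notation mass_of := (class_mass u).
Local Notation tail_of := (class_tail u).
Local Notation dual_of := (class_dual u).
Let u_gt0 : 0 < u. Proof. by move: u_lb; lra. Qed.
Let class_weight_ge0 M i : 0 <= weight_of M i.
Proof. exact: class_weight_ge0. Qed.
Let class_dual_ge0 M j : 0 <= dual_of M j.
Proof. exact: class_dual_ge0. Qed.
Variables (V : finType) (M : V -> nat) (Rt : {set V}) (nb : V -> {set V}).
Hypotheses (M_rg : forall v, (0 < M v <= 4)%N)
  (nb_Rt : forall y c, y \in Rt -> c \in nb y -> c \notin Rt)
  (nb_M : forall y c, y \in Rt -> c \in nb y -> M c = M y)
  (nb_card : forall y, y \in Rt -> #|nb y| = 3)
  (nb_deg : forall c, (#|[set y in Rt | c \in nb y]| <= 3)%N).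

Let S v := mass_of (M v).
Let S_gt0 v : 0 < S v. Proof. exact: class_mass_gt0. Qed.
Let p v (a : 'I_4) : R := weight_of (M v) a / S v.

Let p_ge0 v a : 0 <= p v a.
Proof. by rewrite divr_ge0 ?class_weight_ge0// ltW. Qed.

Let p_sum1 v : \sum_a p v a = 1.
Proof.
rewrite /p -mulr_suml; apply: divff; exact: lt0r_neq0 (S_gt0 v).
Qed.

Implicit Types a : {ffun V -> 'I_4}.

Definition star_ok y a : bool := [forall c in nb y, (M y <= (a c + a y).+1)%N].

Let f y a : R := (star_ok y a)%:R.

Let W y a : R := \sum_b p y b * [forall c in nb y, (M y <= (a c + b).+1)%N]%:R.

Let update_nb i y a b c : i \in Rt -> y \in Rt -> c \in nb y ->
  update a i b c = a c.
Proof.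
move=> iR yR cy; rewrite ffunE; case: eqP => // ci.
by have := nb_Rt yR cy; rewrite ci iR.
Qed.

Let W_indep_Rt i y : i \in Rt -> y \in Rt -> independent i (W y).
Proof.
move=> iR yR a b; apply: eq_bigr => d _; congr (_ * _%:R); congr (nat_of_bool _).
by apply: eq_forallb_in => c cy; rewrite (update_nb _ _ iR yR cy).
Qed.

Let W_indep i y : i \notin nb y -> independent i (W y).
Proof.
move=> iy a b; apply: eq_bigr => d _; congr (_ * _%:R); congr (nat_of_bool _).
apply: eq_forallb_in => c cy; rewrite ffunE; case: eqP => // ci.
by rewrite -ci cy in iy.
Qed.

Let f_indep i y : i \in Rt -> y \in Rt -> i != y -> independent i (f y).
Proof.
move=> iR yR iy a b; congr (_%:R); congr (nat_of_bool _).
apply: eq_forallb_in => c cy; rewrite (update_nb _ _ iR yR cy).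
by rewrite ffunE eq_sym (negbTE iy).
Qed.

Let expect_at_f y a : y \in Rt -> expect_at p y (f y) a = W y a.
Proof.
move=> yR; apply: eq_bigr => b _; congr (_ * _%:R); congr (nat_of_bool _).
by apply: eq_forallb_in => c cy; rewrite (update_nb _ _ yR yR cy) ffunE eqxx.
Qed.

(** No root is a neighbour of a root. Given the other values the roots are thus independent, and
    [f y] averages to [W y], the conditional probability that root [y] is compatible with its
    neighbours. *)
Let expect_Rt : expect p (fun a => \prod_(y in Rt) f y a) =
  expect p (fun a => \prod_(y in Rt) W y a).
Proof.
have step (s : seq V) : uniq s -> {subset s <= Rt} ->
    expect p (fun a => \prod_(y in Rt) f y a) =
    expect p (fun a => \prod_(y in Rt) if y \in s then W y a else f y a).
  elim: s => [_ _|i s IH /andP[iNs us] sR]; first exact: eq_bigr.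
  have iR : i \in Rt by apply: sR; rewrite inE eqxx.
  rewrite IH// => [|y ys]; last by apply: sR; rewrite inE ys orbT.
  rewrite -(expect_expect_at p_sum1 i); apply: eq_bigr => a _; congr (_ * _).
  rewrite (bigD1 i)//= inE eqxx/= -expect_at_f// /expect_at mulr_suml.
  apply: eq_bigr => b _; rewrite (bigD1 i)//= (negbTE iNs) mulrA; congr (_ * _).
  apply: eq_bigr => y /andP[yR yi]; rewrite inE (negbTE yi)/=.
  case: ifP => _; first exact: W_indep_Rt.
  by apply: f_indep => //; rewrite eq_sym.
rewrite (step (enum Rt)) ?enum_uniq//; last by move=> y; rewrite mem_enum.
by apply: eq_bigr => a _; congr (_ * _); apply: eq_bigr => y yR; rewrite mem_enum yR.
Qed.

Let W_gt0 y a : 0 < W y a.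
Proof.
have M1 : ((M y).-1 < 4)%N by case: (M y) (M_rg y).
have M0 : (M y).-1.+1 = M y by case: (M y) (M_rg y).
rewrite /W (bigD1 (Ordinal M1))//= ltr_wpDr//.
  by apply: sumr_ge0 => b _; rewrite mulr_ge0.
rewrite /p /class_weight /= M0 ltnn eqxx.
have -> : [forall c in nb y, (M y <= (a c + (M y).-1).+1)%N] = true.
  by apply/forall_inP => c _; rewrite -addnS M0 leq_addl.
by rewrite mulr1 divr_gt0// exprn_gt0.
Qed.

Let L y j a : bool := [forall c in nb y, (j <= a c)%N].

Let expect_L y j : y \in Rt ->
  expect p (fun a => (L y j a)%:R) = (tail_of (M y) j / S y) ^+ 3.
Proof.
move=> yR; pose g v (b : 'I_4) : R := if v \in nb y then (j <= b)%N%:R else 1.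
transitivity (expect p (fun a => \prod_v g v (a v))).
  apply: eq_bigr => a _; congr (_ * _); rewrite /L /g -big_mkcond/=.
  case: forall_inP => [La|nLa]; first by rewrite big1// => v /La ->.
  have [c cy cj] : exists2 c, c \in nb y & ~~ (j <= a c)%N.
    apply/exists_inP; rewrite -negb_forall_in; apply/negP => /forall_inP.
    exact: nLa.
  by rewrite (bigD1 c)//= (negbTE cj) mul0r.
rewrite expect_prod// (bigID (mem (nb y)))/= [X in _ * X]big1 => [|v vy]; last first.
  by under eq_bigr do rewrite /g (negbTE vy) mulr1; exact: p_sum1.
rewrite mulr1 (eq_bigr (fun=> tail_of (M y) j / S y)).
  by rewrite prodr_const nb_card.
move=> v vy; rewrite /class_tail mulr_suml; apply: eq_bigr => b _.
by rewrite /g vy /p /S (nb_M yR vy) mulrC mulrA.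
Qed.

Let w y j : R := (dual_of (M y) j / S y) ^+ 3.

(** A layer decomposition by the least index among the neighbours: if it is [j], then [W y] is at
    most [class_dual] at [j] over the mass, and the right side telescopes to [w y j]. The
    expectation of the right side is explicit, because each [L y j] is an intersection of three
    independent events. *)
Let W_cube y a : y \in Rt ->
  W y a ^+ 3 <= w y 0%N + (w y 1%N - w y 0%N) * (L y 1 a)%:R
   + (w y 2%N - w y 1%N) * (L y 2 a)%:R + (w y 3%N - w y 2%N) * (L y 3 a)%:R.
Proof.
move=> yR.
have wE j : (forall b : 'I_4, [forall c in nb y, (M y <= (a c + b).+1)%N] ->
    (M y <= (j + b).+1)%N) -> W y a ^+ 3 <= w y j.
  move=> jP; apply: lerXn2r; rewrite ?nnegrE; first exact: ltW.
    by rewrite divr_ge0 ?class_dual_ge0// ltW.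
  rewrite /class_dual mulr_suml; apply: ler_sum => b _.
  rewrite -[leRHS]mulrA [leRHS]mulrC ler_wpM2l ?p_ge0// ler_nat.
  by case: [forall _ in _, _] (jP b) => // ->.
have Lmono i j : (i <= j)%N -> L y j a -> L y i a.
  by move=> ij /forall_inP La; apply/forall_inP => c /La; apply: leq_trans.
have Lfail j : ~~ L y j.+1 a -> W y a ^+ 3 <= w y j.
  rewrite negb_forall_in => /exists_inP[c cy]; rewrite -ltnNge ltnS => acj.
  by apply: wE => b /forall_inP/(_ _ cy) /leq_trans; apply; rewrite ltnS leq_add2r.
have [L1|L1] := boolP (L y 1 a); last first.
  have /negbTE -> : ~~ L y 2 a by apply: contra L1; exact: Lmono.
  have /negbTE -> : ~~ L y 3 a by apply: contra L1; exact: Lmono.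
  by rewrite !mulr0 !addr0; exact: Lfail.
have [L2|L2] := boolP (L y 2 a); last first.
  have /negbTE -> : ~~ L y 3 a by apply: contra L2; exact: Lmono.
  by rewrite !mulr0 !addr0 mulr1 addrC subrK; exact: Lfail.
have [L3|L3] := boolP (L y 3 a); rewrite ?mulr1 ?mulr0 ?addr0.
  rewrite [w y 0%N + _]addrC subrK [w y 1%N + _]addrC subrK [w y 2%N + _]addrC subrK.
  by apply: wE => b _; have /andP[_ /leq_trans] := M_rg y; apply.
rewrite [w y 0%N + _]addrC subrK [w y 1%N + _]addrC subrK; exact: Lfail.
Qed.

Definition star_rate : R := nroot 3 (84 / 100).

Let expect_W y : y \in Rt -> (1 < M y)%N ->
  nroot 3 (expect p (fun a => W y a ^+ 3)) <= star_rate / S y ^+ 2.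
Proof.
move=> yR M1; have S0 := S_gt0 y.

have -> : star_rate / S y ^+ 2 = nroot 3 (84 / 100 / S y ^+ 6).
  rewrite -[LHS](@nrootXn R 3)//; last first.
    by rewrite divr_ge0 ?exprn_ge0 ?nroot_ge0// ltW.
  by rewrite expr_div_n nrootK// ?divr_ge0// -exprM.
apply: ler_nroot => //.
  rewrite /expect; apply: sumr_ge0 => a _; rewrite mulr_ge0 ?prodr_ge0// exprn_ge0//.
  exact: ltW.
have le1 := ler_expect p_ge0 (fun a => W_cube a yR).
apply: (le_trans le1); rewrite !expectD !expectZ !expect_L// expect_cst//.
rewrite ler_pdivlMr ?exprn_gt0//.
have My : (1 < M y <= 4)%N by rewrite M1; case/andP: (M_rg y).
apply: le_trans (star_numeric u_sq u_lb u_ub My).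
rewrite /w /= !expr_div_n -/(S y).
by rewrite le_eqVlt; apply/orP; left; apply/eqP; field; rewrite gt_eqF.
Qed.

(** By [nb_deg] a vertex influences at most three of the [W y], so Finner's inequality with exponent
    3 applies to their cubes. The square in the denominator will cancel the masses of the root and
    of one vertex of the other half. A root with [M y = 1] is unconstrained and contributes no
    factor. *)
Lemma star_bound :
  \sum_(a : {ffun V -> 'I_4})
    (\prod_v weight_of (M v) (a v)) * [forall y in Rt, star_ok y a]%:R <=
  (\prod_v mass_of (M v)) *
  \prod_(y in Rt | (1 < M y)%N) (star_rate / mass_of (M y) ^+ 2).
Proof.
pose F a := \prod_(y in Rt) f y a.
have -> : \sum_(a : {ffun V -> 'I_4})
    (\prod_v weight_of (M v) (a v)) * [forall y in Rt, star_ok y a]%:R =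
    (\prod_v S v) * expect p F.
  rewrite /expect mulr_sumr; apply: eq_bigr => a _.
  rewrite mulrA -big_split/=; congr (_ * _).
    by apply: eq_bigr => v _; rewrite /p mulrC divfK// gt_eqF.
  rewrite /F; case: forall_inP => [ok|nok].
    by rewrite big1// => y /ok; rewrite /f => ->.
  have [c cy cj] : exists2 c, c \in Rt & ~~ star_ok c a.
    apply/exists_inP; rewrite -negb_forall_in; apply/negP => /forall_inP.
    exact: nok.
  by rewrite (bigD1 c)//= /f (negbTE cj) mul0r.
apply: ler_wpM2l; first by apply: prodr_ge0 => v _; exact: ltW.
rewrite /F expect_Rt.
pose H y a := if (y \in Rt) && (1 < M y)%N then W y a ^+ 3 else 1.
apply: (@le_trans _ _ (expect p (fun a => \prod_y nroot 3 (H y a)))).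
  apply: ler_expect => // a; rewrite big_mkcond/=; apply: ler_prod => y _.
  rewrite /H; case: ifP => yR/=; last by rewrite nroot1 ler01 lexx.
  case: ifP => M1; first by rewrite nrootXn ?lexx ?andbT// ltW.
  rewrite nroot1 ltW//= -(p_sum1 y); apply: ler_sum => b _.
  by rewrite ler_piMr// lern1 leq_b1.
apply: (le_trans (@finner R V _ V p 3 isT p_ge0 p_sum1 _ nb_deg H _ _)).
- by move=> y a; rewrite /H; case: ifP => // _; rewrite exprn_gt0.
- move=> i y; rewrite inE negb_and /H => iy x b.
  case: ifP => // /andP[yR _]; rewrite yR /= in iy.
  by rewrite (W_indep iy).
rewrite [leRHS]big_mkcond/=; apply: ler_prod => y _; rewrite nroot_ge0/=.
rewrite /H; case: ifP => [/andP[yR M1]|_]; first exact: expect_W.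
by rewrite expect_cst// nroot1.
Qed.
End StarBound.

(** * Gaps and Kunz coordinates *)

Section Kunz.
Variables (H : {fset nat}) (m : nat).
Hypotheses (H0 : 0%N \notin H)
  (HD : forall x y, x \notin H -> y \notin H -> (x + y)%N \notin H)
  (m_gt0 : (0 < m)%N) (mH : m \notin H).

Lemma sum_mem_leq (n : nat) : (\sum_(i < n) (nat_of_ord i \in H) <= #|` H|)%N.
Proof.
rewrite -(big_mkord predT (fun i => nat_of_bool (i \in H))) -big_mkcond/=.
rewrite sum1_count -size_filter; apply: uniq_leq_size; first by rewrite filter_uniq ?iota_uniq.
by move=> x; rewrite mem_filter => /andP[].
Qed.

(* One of i and x - i is a gap whenever x is. *)
Lemma gap_lt x : x \in H -> (x < 2 * #|` H|)%N.
Proof.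
move=> xH; have := sum_mem_leq x.+1; set s := (\sum_(i < _) _)%N => sH.
apply: (@leq_trans (s + s)); last by rewrite addnn -muln2 mulnC leq_mul2l sH.
rewrite {2}/s (reindex_inj rev_ord_inj)/= -big_split/=.
rewrite -[leqLHS]card_ord -sum1_card leq_sum// => i _.
have ix : (i <= x)%N by rewrite -ltnS.
rewrite subSS lt0n addn_eq0 !eqb0 negb_and !negbK.
by apply: contraLR xH; rewrite negb_or => /andP[/HD h /h]; rewrite subnKC.
Qed.

(** The search always succeeds within this range, since every gap is below twice the genus
    ([kunz_has]). *)
Definition kunz (c : nat) : nat :=
  find (fun j => c + j * m \notin H)%N (iota 0 (2 * #|` H|).+1).

Lemma addM_notin x j : x \notin H -> (x + j * m)%N \notin H.
Proof.
by move=> xH; elim: j => [|j IH]; rewrite ?mul0n ?addn0// mulSnr addnA HD.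
Qed.

Lemma kunz_has c : has (fun j => c + j * m \notin H)%N (iota 0 (2 * #|` H|).+1).
Proof.
apply/hasP; exists (2 * #|` H|)%N; first by rewrite mem_iota/= add0n.
apply/negP => /gap_lt; rewrite ltnNge => /negP; apply.
by rewrite (leq_trans _ (leq_addl _ _))// leq_pmulr.
Qed.

Lemma mem_kunz c j : (c + j * m \in H)%N = (j < kunz c)%N.
Proof.
have lt_k : (kunz c < (2 * #|` H|).+1)%N.
  by have := kunz_has c; rewrite has_find size_iota.
case: ltnP => jk.
  have := before_find 0%N jk; rewrite nth_iota ?add0n ?(ltn_trans jk lt_k)//.
  by move=> /negbFE.
have := nth_find 0%N (kunz_has c); rewrite nth_iota// add0n => kH.
by apply/negbTE; rewrite -(subnKC jk) mulnDl addnA addM_notin.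
Qed.

Lemma kunz_leq c : (kunz c <= #|` H|)%N.
Proof.
have inj_c : injective (fun j => c + j * m)%N.
  by move=> i j /addnI/eqP; rewrite eqn_pmul2r// => /eqP.
have -> : kunz c = size [seq (c + j * m)%N | j <- iota 0 (kunz c)].
  by rewrite size_map size_iota.
apply: uniq_leq_size; first by rewrite map_inj_uniq ?iota_uniq.
by move=> x /mapP[j]; rewrite mem_iota add0n /= -mem_kunz => ? ->.
Qed.

Lemma mem_kunz_mod x : (x \in H) = (x %/ m < kunz (x %% m))%N.
Proof. by rewrite -mem_kunz {1}(divn_eq x m) addnC. Qed.

Lemma kunz0 : kunz 0 = 0%N.
Proof. by apply/eqP; rewrite -leqn0 leqNgt -mem_kunz mul0n. Qed.

Lemma kunz_gt0 c : (0 < kunz c)%N = (c \in H).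
Proof. by rewrite -mem_kunz mul0n addn0. Qed.

(** Otherwise the gap would be a sum of two elements of the semigroup, one from each column. All
    constraints between coordinates come from here. *)
Lemma kunz_subadd c c' q :
  (c + c' + q * m \in H)%N -> (q < kunz c + kunz c')%N.
Proof.
apply: contraLR; rewrite -leqNgt => kq.
have c1 : (c + kunz c * m)%N \notin H by rewrite mem_kunz ltnn.
have c2 : (c' + (q - kunz c) * m)%N \notin H by rewrite mem_kunz -leqNgt; lia.
have := HD c1 c2; rewrite addnACA -mulnDl subnKC//; lia.
Qed.

Lemma sum_gaps (f : nat -> nat) :
  (\sum_(x <- H) f x = \sum_(c < m) \sum_(j < kunz c) f (c + j * m))%N.
Proof.
rewrite -(big_mkord predT (fun c => \sum_(j < kunz c) f (c + j * m)%N)%N).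
under [RHS]eq_bigr => c _ do
  rewrite -(big_mkord predT (fun j => f (c + j * m)%N)).
rewrite /index_iota subn0.
under [RHS]eq_bigr => c _ do rewrite subn0.
transitivity (\sum_(x <- [seq (c + j * m)%N | c <- iota 0 m, j <- iota 0 (kunz c)]) f x)%N;
  last by rewrite big_allpairs_dep.
apply: perm_big; apply: uniq_perm; first exact: fset_uniq.
  apply: allpairs_uniq_dep => [|c _|]; rewrite ?iota_uniq//.
  move=> x y /allpairsPdep[c [j [+ _ ->]]] /allpairsPdep[c' [j' [+ _ ->]]].
  rewrite !mem_iota/= !add0n => cm c'm e.
  have ec : c = c'.
    have := congr1 (modn^~ m) e.
    by rewrite /= !(addnC _ (_ * m)%N) !modnMDl !modn_small.
  by move: e; rewrite ec => /addnI/eqP; rewrite eqn_pmul2r// => /eqP ->.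
move=> x; apply/idP/allpairsPdep => [xH|[c [j [_ +] ->]]].
  exists (x %% m)%N, (x %/ m)%N; split; rewrite ?mem_iota/= ?add0n ?ltn_mod//.
    by rewrite -mem_kunz_mod.
  by rewrite addnC -divn_eq.
by rewrite mem_iota/= add0n -mem_kunz.
Qed.

Lemma sum_kunz : (\sum_(c < m) kunz c = #|` H|)%N.
Proof.
have := sum_gaps (fun=> 1%N); rewrite big_const_seq count_predT iter_addn_0 mul1n.
move=> ->; apply: eq_bigr => c _.
by rewrite sum_nat_const card_ord muln1.
Qed.

End Kunz.

Lemma kunz_inj (H H' : {fset nat}) (m : nat) : (0 < m)%N ->
  0%N \notin H -> (forall x y, x \notin H -> y \notin H -> (x + y)%N \notin H) ->
  m \notin H ->
  0%N \notin H' -> (forall x y, x \notin H' -> y \notin H' -> (x + y)%N \notin H') ->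
  m \notin H' ->
  (forall c, (c < m)%N -> kunz H m c = kunz H' m c) -> H = H'.
Proof.
move=> m0 H0 HD mH H0' HD' mH' e; apply/fsetP => x.
by rewrite (mem_kunz_mod HD m0 mH) (mem_kunz_mod HD' m0 mH') e// ltn_mod.
Qed.

Lemma NS_gaps (g : nat) (H : {fset nat}) : NS g H ->
  [/\ 0%N \notin H,
      (forall x y, x \notin H -> y \notin H -> (x + y)%N \notin H)
    & #|` H| = g].
Proof.
move=> [[S0 [SD _]] gH]; split=> //; first exact/negP.
by move=> x y /negP xS /negP yS; apply/negP; exact: SD.
Qed.

Lemma gaps_NS (H : {fset nat}) : 0%N \notin H ->
  (forall x y, x \notin H -> y \notin H -> (x + y)%N \notin H) ->
  NS #|` H| H.
Proof.
move=> H0 HD; split=> //; split; first exact/negP.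
split=> [x y /negP xS /negP yS|]; first by apply/negP/HD.
by rewrite /semigroup_of setCK; exact: finite_fset.
Qed.

Definition multiplicity_of (m : nat) (H : {fset nat}) : Prop :=
  [/\ (0 < m)%N, m \notin H & forall c, (0 < c < m)%N -> c \in H].

(** The positive integers up to genus plus one are too many to be all gaps; the least non-gap among
    them is the multiplicity. *)
Lemma multiplicity_exists (H : {fset nat}) :
  exists2 m, (m <= #|` H|.+1)%N & multiplicity_of m H.
Proof.
have ex : exists m, (0 < m)%N && (m \notin H) && (m <= #|` H|.+1)%N.
  apply: contrapT => nex.
  have /uniq_leq_size : uniq (iota 1 #|` H|.+1) by exact: iota_uniq.
  move=> /(_ H) le; have : (#|` H|.+1 <= #|` H|)%N.
    rewrite -{1}(size_iota 1 #|` H|.+1); apply: le => x.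
    rewrite mem_iota => /andP[x0]; rewrite add1n ltnS => xg.
    by apply: contrapT => /negP xH; apply: nex; exists x; rewrite x0 xH.
  by rewrite ltnn.
case: (ex_minnP ex) => m /andP[/andP[m0 mH] mg] mmin; exists m => //.
split=> // c /andP[c0 cm]; apply: contraLR cm => cH.
rewrite -leqNgt; have [cg|gc] := leqP c #|` H|.+1; last first.
  exact: leq_trans mg (ltnW gc).
by apply: mmin; rewrite c0 cH.
Qed.

(** * The Fibonacci lower bound *)

Lemma finite_NS (g : nat) : finite_set (NS g).
Proof.
pose X := fpowerset [fset x in iota 0 (2 * g)]%fset.
apply: (@sub_finite_set _ _ [set` X]); last exact: finite_fset.
move=> H /NS_gaps[H0 HD gH] /=; rewrite fpowersetE.
apply/fsubsetP => x /(gap_lt HD) xg.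
by rewrite in_fset /= mem_iota add0n -gH.
Qed.

Definition semigroups (g : nat) : {fset {fset nat}} := fset_set (NS g).

Lemma in_semigroups g H : (H \in semigroups g) = (H \in NS g).
Proof. by rewrite in_fset_set//; exact: finite_NS. Qed.

Lemma mem_semigroups g H : H \in semigroups g -> NS g H.
Proof. by rewrite in_semigroups => /set_mem. Qed.

(* The sequences of Kunz coordinates of the semigroups of genus g whose gaps are
   all smaller than twice the multiplicity. *)
Fixpoint compositions12 (g : nat) : seq (seq nat) :=
  match g with
  | 0%N => [:: [::]]
  | g1.+1 => match g1 with
    | 0%N => [:: [:: 1%N]]
    | g2.+1 => [seq (1%N :: l) | l <- compositions12 g1] ++
               [seq (2%N :: l) | l <- compositions12 g2]
    end
  end.

Lemma ind2 (P : nat -> Prop) :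
  P 0%N -> P 1%N -> (forall n, P n -> P n.+1 -> P n.+2) -> forall n, P n.
Proof.
move=> P0 P1 PS n; suff : P n /\ P n.+1 by case.
by elim: n => // n [Pn Pn1]; split=> //; exact: PS.
Qed.

Lemma compositions12P g l : l \in compositions12 g ->
  sumn l = g /\ all (fun k => 0 < k <= 2)%N l.
Proof.
elim/ind2: g l => [l|l|g IH IH1 l]; rewrite ?inE; try by move=> /eqP ->.
rewrite mem_cat => /orP[] /mapP[l' +  ->] /=.
  by move=> /IH1[-> ->].
by move=> /IH[-> ->].
Qed.

Lemma compositions12_uniq g : uniq (compositions12 g).
Proof.
elim/ind2: g => // g IH IH1; rewrite [compositions12 _]/=.
rewrite cat_uniq !map_inj_uniq ?IH1 ?IH//; try by move=> x y [].
by rewrite andbT; apply/hasPn => _ /mapP[l _ ->]; apply/negP => /mapP[].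
Qed.

(** The prepended 0 is the coordinate of the class of multiples of the multiplicity [(size l).+1].
    The range suffices for entries at most 2. *)
Definition gaps_of (l : seq nat) : {fset nat} :=
  [fset x in [seq x <- iota 0 (3 * (size l).+1) |
     (x %/ (size l).+1 < nth 0 (0 :: l) (x %% (size l).+1))%N]]%fset.

Section GapsOf.
Variable l : seq nat.
Hypothesis l12 : all (fun k => 0 < k <= 2)%N l.
Let m := (size l).+1.

Let nth12 c : (nth 0 (0 :: l) c <= 2)%N.
Proof.
have [cl|cl] := ltnP c (size (0%N :: l)); last by rewrite nth_default.
by case: c cl => //= c cl; have /andP[] := all_nthP 0%N l12 c cl.
Qed.

Lemma mem_gaps_of x : (x \in gaps_of l) = (x %/ m < nth 0 (0 :: l) (x %% m))%N.
Proof.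
rewrite /gaps_of -/m; move N : (3 * m)%N => n.
rewrite in_fset /= mem_filter andb_idr// => xk.
rewrite mem_iota add0n leq0n -N -ltn_divLR//.
by rewrite (leq_trans xk)// (leq_trans (nth12 _)).
Qed.

Lemma gaps_of0 : 0%N \notin gaps_of l.
Proof. by rewrite mem_gaps_of mod0n ltn0. Qed.

(** Adding a multiple of [m] only moves up in a column. Non-gaps in the other classes are at least
    [m], so two of them add up to at least [2 * m], where no gaps are left. *)
Lemma gaps_ofD x y :
  x \notin gaps_of l -> y \notin gaps_of l -> (x + y)%N \notin gaps_of l.
Proof.
rewrite !mem_gaps_of -!leqNgt.
have small z : (z %% m != 0)%N -> (nth 0 (0 :: l) (z %% m) <= z %/ m)%N -> (m <= z)%N.
  move=> z0 zk; rewrite leqNgt; apply/negP => zm.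
  move: zk; rewrite divn_small// modn_small//.
  rewrite modn_small// in z0; case: z z0 zm => // z _ zm /=.
  by have /andP[+ _] := all_nthP 0%N l12 z zm; rewrite leqn0 => /[swap] /eqP ->.
have [x0 xk yk|x0 xk] := eqVneq (x %% m)%N 0%N.
  rewrite (divn_eq x m) x0 addn0 modnMDl divnMDl//.
  by rewrite (leq_trans yk)// leq_addl.
have [y0 yk|y0 yk] := eqVneq (y %% m)%N 0%N.
  rewrite addnC (divn_eq y m) y0 addn0 modnMDl divnMDl//.
  by rewrite (leq_trans xk)// leq_addl.
apply: (leq_trans (nth12 _)); rewrite leq_divRL// mul2n -addnn leq_add//.
  exact: small.
exact: small.
Qed.

Lemma gaps_of_multiplicity : multiplicity_of m (gaps_of l).
Proof.
split=> // [|c /andP[c0 cm]]; rewrite mem_gaps_of ?modnn// divn_small// modn_small//.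
case: c c0 cm => // c _ cm /=.
by have /andP[] := all_nthP 0%N l12 c cm.
Qed.

Lemma kunz_gaps_of c : (c < m)%N -> kunz (gaps_of l) m c = nth 0%N (0%N :: l) c.
Proof.
move=> cm; have [m0 mH _] := gaps_of_multiplicity.
have e j : (j < kunz (gaps_of l) m c)%N = (j < nth 0 (0 :: l) c)%N.
  rewrite -mem_kunz//; last exact: gaps_ofD.
  by rewrite mem_gaps_of addnC modnMDl divnMDl// modn_small// divn_small// addn0.
apply/eqP; rewrite eqn_leq.
by have := e (nth 0 (0 :: l) c)%N; have := e (kunz (gaps_of l) m c);
  rewrite !ltnn; do 2![case: leqP].
Qed.

Lemma card_gaps_of : #|` gaps_of l| = sumn l.
Proof.
have [m0 mH _] := gaps_of_multiplicity.
rewrite -(sum_kunz gaps_ofD m0 mH) (eq_bigr (fun c : 'I_m => nth 0 (0 :: l) c)%N).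
  by rewrite -[RHS]/(sumn (0%N :: l)) [RHS]sumnE (big_nth 0%N) big_mkord.
by move=> c _; exact: kunz_gaps_of.
Qed.

End GapsOf.

Lemma multiplicity_uniq m m' H : multiplicity_of m H -> multiplicity_of m' H -> m = m'.
Proof.
case=> m0 mH mP; case=> m'0 m'H m'P.
have [lt|lt|//] := ltngtP m m'.
  by have := m'P m; rewrite m0 lt (negbTE mH) => /(_ isT).
by have := mP m'; rewrite m'0 lt (negbTE m'H) => /(_ isT).
Qed.

Lemma gaps_of_inj g : {in compositions12 g &, injective gaps_of}.
Proof.
move=> l l' /compositions12P[_ l12] /compositions12P[_ l'12] e.
have := multiplicity_uniq (gaps_of_multiplicity l12).
move=> /(_ (size l').+1); rewrite e => /(_ (gaps_of_multiplicity l'12)) [es].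
apply: (@eq_from_nth _ 0%N) => // i il.
have iA : (i.+1 < (size l).+1)%N by [].
have iB : (i.+1 < (size l').+1)%N by rewrite -es.
by have := kunz_gaps_of l12 iA; rewrite e es (kunz_gaps_of l'12 iB).
Qed.

Lemma size_compositions12 g : (size (compositions12 g) <= #|` semigroups g|)%N.
Proof.
rewrite -(size_map gaps_of); apply: uniq_leq_size.
  rewrite map_inj_in_uniq ?compositions12_uniq//; exact: gaps_of_inj.
move=> _ /mapP[l /compositions12P[lg l12] ->].
rewrite in_semigroups; apply/mem_set; rewrite -lg -card_gaps_of//.
by apply: gaps_NS; [exact: gaps_of0|exact: gaps_ofD].
Qed.

Section LowerBound.
Variables (R : realType) (u : R).
Hypotheses (u_sq : u ^+ 2 = 1 - u) (u_gt0 : 0 < u) (u_lt1 : u < 1).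

(** The Fibonacci recursion of [compositions12] preserves the bound because u^2 + u^3 = u. *)
Lemma card_semigroups_ge g : u <= #|` semigroups g|%:R * u ^+ g.
Proof.
apply: (@le_trans _ _ ((size (compositions12 g))%:R * u ^+ g)); last first.
  by rewrite ler_wpM2r ?exprn_ge0 ?(ltW u_gt0)// ler_nat size_compositions12.
elim/ind2: g => [||g IH IH1].
- by rewrite expr0 mulr1 ltW.
- by rewrite expr1 mul1r.
rewrite [compositions12 _]/= size_cat !size_map natrD mulrDl.
have u_sum : u * u + u ^+ 2 * u = u by rewrite u_sq mulrBl mul1r -expr2 u_sq; ring.
rewrite -[leLHS]u_sum.
apply: lerD; first by rewrite exprS mulrCA ler_wpM2l// ltW.
by rewrite -[g.+2]addn2 exprD mulrA [leRHS]mulrC ler_wpM2l// exprn_ge0// ltW.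
Qed.

End LowerBound.

(** * Counting through Kunz coordinates *)

Section Counting.
Variable R : realType.

Definition count_semigroups (g : nat) (P : {fset nat} -> Prop) : R :=
  \sum_(H <- semigroups g) `[< P H >]%:R.

Lemma ler_count_semigroups g (P Q : {fset nat} -> Prop) :
  (forall H, NS g H -> P H -> Q H) ->
  count_semigroups g P <= count_semigroups g Q.
Proof.
move=> PQ; rewrite /count_semigroups !big_seq; apply: ler_sum => H.
move=> /mem_semigroups HN; rewrite ler_nat.
by case: (asboolP (P H)) => // /(PQ H HN) QH; case: asboolP.
Qed.

Lemma count_semigroups_ge0 g P : 0 <= count_semigroups g P.
Proof. exact: sumr_ge0. Qed.

Lemma count_semigroups_bigcup g (I : finType) (P : {fset nat} -> Prop)
    (Q : I -> {fset nat} -> Prop) :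
  (forall H, NS g H -> P H -> exists i, Q i H) ->
  count_semigroups g P <= \sum_i count_semigroups g (Q i).
Proof.
move=> PQ; rewrite /count_semigroups exchange_big/= !big_seq; apply: ler_sum => H.
move=> /mem_semigroups HN; case: asboolP => [/(PQ _ HN)[i Qi]|_]; last first.
  exact: sumr_ge0.
rewrite (bigD1 i)//= (asboolT Qi) lerDl; exact: sumr_ge0.
Qed.

(** Class 0 is left out: index [i] stands for class [i.+1]. Coordinates are at most the genus, so
    [inord] does not fall back to its default for semigroups of genus [g]. *)
Definition kunz_vector (g n : nat) (H : {fset nat}) : {ffun 'I_n -> 'I_g.+1} :=
  [ffun i : 'I_n => inord (kunz H n.+1 i.+1)].

Section KunzVector.
Variables (g n : nat) (H : {fset nat}).
Hypotheses (HN : NS g H) (Hm : multiplicity_of n.+1 H).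

Lemma kunz_vectorE (i : 'I_n) : kunz_vector g n H i = kunz H n.+1 i.+1 :> nat.
Proof.
have [H0 HD gH] := NS_gaps HN; have [_ mH _] := Hm.
by rewrite ffunE inordK// ltnS -gH kunz_leq.
Qed.

Lemma kunz_vector_gt0 (i : 'I_n) : (0 < kunz_vector g n H i)%N.
Proof.
have [H0 HD gH] := NS_gaps HN; have [_ mH Hc] := Hm.
by rewrite kunz_vectorE kunz_gt0// Hc//= ltnS ltn_ord.
Qed.

Lemma sum_gaps_vector (f : nat -> nat) :
  (\sum_(x <- H) f x =
   \sum_(i < n) \sum_(j < kunz_vector g n H i) f (i.+1 + j * n.+1))%N.
Proof.
have [H0 HD gH] := NS_gaps HN; have [_ mH Hc] := Hm.
rewrite (sum_gaps HD _ mH)// big_ord_recl/= kunz0// big_ord0 add0n.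
by apply: eq_bigr => i _; rewrite kunz_vectorE.
Qed.

Lemma sum_kunz_vector : (\sum_(i < n) kunz_vector g n H i = g)%N.
Proof.
have [_ _ gH] := NS_gaps HN; have := sum_gaps_vector (fun=> 1%N).
rewrite big_const_seq count_predT iter_addn_0 mul1n gH => e; rewrite [RHS]e.
by apply: eq_bigr => i _; rewrite sum_nat_const card_ord muln1.
Qed.

End KunzVector.

Lemma kunz_vector_inj g n (H H' : {fset nat}) :
  NS g H -> multiplicity_of n.+1 H -> NS g H' -> multiplicity_of n.+1 H' ->
  kunz_vector g n H = kunz_vector g n H' -> H = H'.
Proof.
move=> HN Hm HN' Hm' e.
have [H0 HD gH] := NS_gaps HN; have [_ mH _] := Hm.
have [H0' HD' gH'] := NS_gaps HN'; have [_ mH' _] := Hm'.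
apply: (@kunz_inj _ _ n.+1) => // -[_|c cm]; first by rewrite !kunz0.
have cn : (c < n)%N by [].
have /(congr1 val)/= := congr1 (fun k : {ffun _} => k (Ordinal cn)) e.
by rewrite !kunz_vectorE.
Qed.

(** Markov's inequality after an injection: the Kunz vector determines the semigroup, so [G] may be
    summed over all vectors, realizable or not. *)
Lemma count_kunz_le g n (P : {fset nat} -> Prop) (a : R)
    (G : {ffun 'I_n -> 'I_g.+1} -> R) :
  (forall k, 0 <= G k) ->
  (forall H, NS g H -> multiplicity_of n.+1 H -> P H -> a <= G (kunz_vector g n H)) ->
  a * count_semigroups g (fun H => multiplicity_of n.+1 H /\ P H) <= \sum_k G k.
Proof.
move=> G0 aG; pose Q H := `[< multiplicity_of n.+1 H /\ P H >].
pose s := [seq H <- semigroups g | Q H].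
have sP H : H \in s -> [/\ NS g H, multiplicity_of n.+1 H & P H].
  by rewrite mem_filter => /andP[/asboolP[? ?] /mem_semigroups].
apply: (@le_trans _ _ (\sum_(H <- s) G (kunz_vector g n H))).
  rewrite /count_semigroups mulr_sumr big_filter big_mkcond/= [leRHS]big_mkcond.
  rewrite !big_seq; apply: ler_sum => H /mem_semigroups HN.
  rewrite /Q; case: asboolP => [[Hm HP]|_]; last by rewrite mulr0.
  by rewrite mulr1 aG.
rewrite -(big_map (kunz_vector g n) predT G) big_uniq/=; last first.
  rewrite map_inj_in_uniq ?filter_uniq ?fset_uniq// => H H' /sP[? ? _] /sP[? ? _].
  exact: kunz_vector_inj.
rewrite big_mkcond; apply: ler_sum => k _; by case: ifP.
Qed.

Lemma sum_prod_ffun (V A : finType) (w : V -> A -> R) :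
  \sum_(k : {ffun V -> A}) \prod_v w v (k v) = \prod_v \sum_a w v a.
Proof. by rewrite bigA_distr_bigA. Qed.

Lemma geometric_le (z : R) n : 0 <= z < 1 -> \sum_(i < n) z ^+ i <= (1 - z)^-1.
Proof.
move=> /andP[z0 z1]; have z10 : 0 < 1 - z by lra.
rewrite -[leRHS]mul1r ler_pdivlMr// mulrC -opprB mulNr -subrX1 opprB.
by rewrite lerBlDr lerDl exprn_ge0.
Qed.

Lemma ler_sum_ord_recl2 (f : nat -> R) n : (forall j, 0 <= f j) ->
  \sum_(j < n.+1) f j <= f 0%N + f 1%N + \sum_(j < n) f j.+2.
Proof.
move=> f0; rewrite -addrA -!(big_mkord predT f) -(big_mkord predT (fun j => f j.+2)).
apply: (@le_trans _ _ (\sum_(0 <= j < n.+2) f j)).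
  by rewrite [leRHS]big_nat_recr//= lerDl.
by rewrite !big_mkord !big_ord_recl.
Qed.

End Counting.

(** * Many gaps above twice the multiplicity *)

Lemma card_ord_range n a b : (b <= n)%N -> #|[set i : 'I_n | (a <= i < b)%N]%SET| = (b - a)%N.
Proof.
move=> bn; rewrite -sum1_card -[RHS]muln1 -sum_nat_const_nat big_geq_mkord/=.
rewrite (big_ord_widen_cond n (fun i => a <= i)%N (fun=> 1%N) bn)/=.
by apply: eq_bigl => i; rewrite inE.
Qed.

(* With multiplicity n.+1, the index i : 'I_n stands for the residue class i.+1.
   The classes i.+1 <= x and i.+1 > x form two blocks; when e - d is a gap, with e = q * n.+1 + x, the Kunz coordinates of two
   classes of a block adding up to the reflection centre minus d cannot both be
   small. *)
Section Blocks.
Variables (n x K q : nat) (D : {set 'I_K}).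
Hypotheses (xn : (x <= n)%N) (q_gt1 : (1 < q)%N) (D3 : #|D| = 3).

Definition low_block (i : 'I_n) : bool := (i.+1 <= x)%N.
(** The number of integers up to e in the column of class [i.+1]; what a Kunz coordinate has beyond
    it counts gaps above e. *)
Definition column_length i := if low_block i then q.+1 else q.
(** If two positive coordinates add up to at least N, then capped at M = min(N, 5) - 1 they add up
    to at least M + 1. The cap 5 leaves four values per coordinate, whatever the length of the
    column. *)
Definition column_class i := (minn (column_length i) 5).-1.
(** When two classes of a block add up to the centre minus d, the gap e - d exceeds their sum by
    [column_length - 1] times the multiplicity, so by [kunz_subadd] their coordinates add up to at
    least [column_length]. *)
Definition reflection_centre i := if low_block i then x else (x + n.+1)%N.
Definition block_start i := if low_block i then 0%N else x.
(** The first condition keeps partners of members out of the set, which makes the system bipartite;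
    the second keeps all reflections with d < K inside the block, so that there are exactly three
    partners. *)
Definition right_half : {set 'I_n} :=
  [set y : 'I_n | (reflection_centre y < 2 * y.+1)%N &
    (y.+1 + K + block_start y < reflection_centre y)%N]%SET.
Definition partners (y : 'I_n) : {set 'I_n} :=
  [set c | (low_block c == low_block y) &
    [exists d in D, (c.+1 + y.+1 + d == reflection_centre y)%N]]%SET.

Lemma column_class_bounds i : (0 < column_class i <= 4)%N.
Proof using q_gt1.
by rewrite /column_class /column_length; case: ifP => _; move: q_gt1; clear; lia.
Qed.

Lemma partnersP y c : c \in partners y ->
  low_block c = low_block y /\
  exists2 d, d \in D & (c.+1 + y.+1 + d = reflection_centre y)%N.
Proof using Type.
by rewrite inE => /andP[/eqP -> /exists_inP[d dD /eqP e]]; split=> //; exists d.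
Qed.

Lemma partners_notin y c : y \in right_half -> c \in partners y ->
  c \notin right_half.
Proof using Type.
rewrite !inE => /andP[y1 _] /andP[/eqP cy /exists_inP[d dD /eqP e]].
rewrite negb_and -leqNgt; apply/orP; left.
by move: y1 e; rewrite /reflection_centre cy; case: ifP => _; clear; lia.
Qed.

Lemma partners_class y c : y \in right_half -> c \in partners y ->
  column_class c = column_class y.
Proof using Type.
by move=> _ /partnersP[e _]; rewrite /column_class /column_length e.
Qed.

Lemma card_partners y : y \in right_half -> #|partners y| = 3.
Proof using xn D3.
rewrite inE => /andP[y1 y2]; rewrite -D3.
have lt_n (d : 'I_K) : ((reflection_centre y - d - y.+1).-1 < n)%N.
  move: y1 y2; rewrite /reflection_centre /block_start.
  by have := ltn_ord y; have := ltn_ord d; case: ifP => yb; move: xn; clear; lia.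
pose h (d : 'I_K) : 'I_n := Ordinal (lt_n d).
have hE (d : 'I_K) : ((h d).+1 + y.+1 + d = reflection_centre y)%N.
  by rewrite /=; have := ltn_ord d; move: y1 y2; clear; lia.
rewrite -(card_imset (mem D) (f := h)); last first.
  move=> d d' dd'; apply/val_inj; have := hE d; rewrite dd' -(hE d').
  by move=> /addnI.
apply: eq_card => c; apply/idP/imsetP => [/partnersP[cy [d dD e]]|[d dD ->{c}]].
  by exists d => //; apply/val_inj => /=; move: e; clear; lia.
rewrite inE; apply/andP; split; last by apply/exists_inP; exists d; rewrite ?hE.
have := hE d; move: y1 y2; rewrite /reflection_centre /block_start.
rewrite /low_block; have := ltn_ord d; move: (h d) => c.
by case: ifP => yb; rewrite ?eqb_id ?eqbF_neg; move: xn; clear; lia.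
Qed.

(** The class [c] and the offset [d] determine [y], and there are three offsets; [y0] serves as the
    default value of [insubd]. *)
Lemma partners_degree c : (#|[set y in right_half | c \in partners y]%SET| <= 3)%N.
Proof using D3.
have [->|] := eqVneq [set y in right_half | c \in partners y]%SET finset.set0.
  by rewrite cards0.
case/finset.set0Pn => y0 _.
have n0 : (0 < n)%N by case: (n) y0 => // -[].
pose h (d : 'I_K) : 'I_n := insubd y0 (reflection_centre c - d - c.+1).-1.
have imD := leq_imset_card h D; rewrite D3 in imD.
apply: leq_trans imD; apply: subset_leq_card.
apply/fintype.subsetP => y; rewrite inE => /andP[_ /partnersP[cy [d dD e]]].
apply/imsetP; exists d => //; apply/val_inj; rewrite /h val_insubd.
have -> : (reflection_centre c - d - c.+1).-1 = y.
  by rewrite /reflection_centre cy -/(reflection_centre y) -e; clear; lia.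
by rewrite ltn_ord.
Qed.

Lemma card_low_block : #|[set i | low_block i]%SET| = x.
Proof using xn.
rewrite -[RHS]subn0 -(card_ord_range 0 xn).
by apply: eq_card => i; rewrite !inE.
Qed.

Lemma card_high_block : #|[set i | ~~ low_block i]%SET| = (n - x)%N.
Proof using Type.
rewrite -(card_ord_range x (leqnn n)).
by apply: eq_card => i; rewrite !inE /low_block ltn_ord andbT -leqNgt.
Qed.

Lemma card_right_low :
  #|[set y in right_half | low_block y]%SET| = (x - K.+1 - x./2)%N.
Proof using xn.
rewrite -(@card_ord_range n); last by move: xn; clear; lia.
apply: eq_card => i; rewrite !inE /reflection_centre /block_start.
by rewrite /low_block; have := ltn_ord i; move: xn; clear; case: ifP => ix; lia.
Qed.

Lemma card_right_high :
  #|[set y in right_half | ~~ low_block y]%SET| = (n - K - (x + n.+1)./2)%N.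
Proof using xn.
rewrite -(@card_ord_range n); last by move: xn; clear; lia.
apply: eq_card => i; rewrite !inE /reflection_centre /block_start.
by rewrite /low_block; have := ltn_ord i; move: xn; clear; case: ifP => ix; lia.
Qed.

End Blocks.

Section BlockSum.
Variables (R : realType) (u : R).
Hypotheses (u_sq : u ^+ 2 = 1 - u) (u_lb : 618 / 1000 < u)
  (u_ub : u < 6181 / 10000).
Local Notation rho := (star_rate R).

Lemma star_rate_bounds : 0 < rho < 1.
Proof.
have lt1 : rho ^+ 3 < 1 by rewrite /star_rate nrootK//; lra.
rewrite /star_rate powR_gt0 ?divr_gt0//= ltNge; apply/negP => ge1.
by move: lt1; rewrite ltNge exprn_ege1.
Qed.

Lemma class_mass1 : class_mass u 1 = 1.
Proof.
rewrite /class_mass /class_weight !big_ord_recl big_ord0 /= /bump /=.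
by rewrite expr0 !addr0.
Qed.

(** The [r] roots cancel the masses of [2 * r] of the [b] vertices; at most [c] vertices remain,
    each of mass at most 2. *)
Lemma block_power_le (M r b c : nat) : (0 < M <= 4)%N -> (2 * r <= b)%N ->
  (b <= 2 * r + c)%N ->
  class_mass u M ^+ b * (if (1 < M)%N then rho / class_mass u M ^+ 2 else 1) ^+ r
  <= 2 ^+ c * (if (1 < M)%N then rho else 1) ^+ r.
Proof.
move=> M4 rb bc; have [r0 r1] := andP star_rate_bounds.
have S0 := class_mass_gt0 u_sq u_lb u_ub M4.
have /andP[S1 S2] := class_mass_ge1 u_sq u_lb u_ub M4.
have [M1|M1] := ltnP 1 M; last first.
  have -> : M = 1%N by clear -M4 M1; lia.
  by rewrite class_mass1 !expr1n !mulr1 exprn_ege1// ler1n.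
rewrite expr_div_n -exprM mulrCA [leRHS]mulrC ler_wpM2l ?exprn_ge0 ?(ltW r0)//.
rewrite -(subnK rb) exprD mulfK ?expf_neq0 ?gt_eqF//.
apply: (@le_trans _ _ (2 ^+ (b - 2 * r))); first by rewrite lerXn2r ?nnegrE ?(ltW S0).
by rewrite ler_weXn2l ?ler1n// leq_subLR.
Qed.

(** For [q = 2] the classes above [x] have [column_class] 1 and carry no constraint, so the decay
    comes from the [x] low classes alone; for larger [q] both blocks contribute. *)
Lemma block_sum (n x K q l : nat) (D : {set 'I_K}) :
  (x <= n)%N -> (1 < q)%N -> #|D| = 3 ->
  (2 * l + 4 * K + 4 <= if q == 2%N then x else n)%N ->
  \sum_(a : {ffun 'I_n -> 'I_4})
    (\prod_v class_weight u (column_class x q v) (a v)) *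
    [forall y in right_half n x K, star_ok (column_class x q) (partners x D) y a]%:R
  <= 2 ^+ (4 * K + 8) * rho ^+ l.
Proof.
move=> xn q1 D3 ll; have [r0 r1] := andP star_rate_bounds.
apply: (le_trans (star_bound u_sq u_lb u_ub _ _ _ _ _)).
- exact: column_class_bounds.
- exact: partners_notin.
- exact: partners_class.
- by move=> y yR; rewrite (card_partners xn D3).
- by move=> c; exact: (partners_degree _ D3).
set M1 := (minn q.+1 5).-1; set M2 := (minn q 5).-1.
pose T M : R := if (1 < M)%N then rho / class_mass u M ^+ 2 else 1.
set r_ := #|[set y in right_half n x K | low_block x y]%SET|.
set r' := #|[set y in right_half n x K | ~~ low_block x y]%SET|.
have -> : \prod_(v < n) class_mass u (column_class x q v) =
    class_mass u M1 ^+ x * class_mass u M2 ^+ (n - x).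
  transitivity ((\prod_(v in [set v | low_block (n := n) x v]%SET) class_mass u M1) *
    \prod_(v in [set v | ~~ low_block (n := n) x v]%SET) class_mass u M2); last first.
    by rewrite !prodr_const (card_low_block xn) card_high_block.
  rewrite (bigID (low_block x))/=; congr (_ * _).
    rewrite [RHS](eq_bigl (low_block x)) => [|v]; last by rewrite inE.
    by apply: eq_bigr => v; rewrite /column_class /column_length => ->.
  rewrite [RHS](eq_bigl (fun v => ~~ low_block x v)) => [|v]; last by rewrite inE.
  by apply: eq_bigr => v; rewrite /column_class /column_length => /negbTE ->.
have -> : \prod_(y in right_half n x K | (1 < column_class x q y)%N)
     (rho / class_mass u (column_class x q y) ^+ 2) = T M1 ^+ r_ * T M2 ^+ r'.
  rewrite -!prodr_const big_mkcondr/= (bigID (low_block x))/=; congr (_ * _).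
    rewrite [RHS](eq_bigl (fun y => (y \in right_half n x K) && low_block x y)) => [|v].
      by apply: eq_bigr => v /andP[_ bv]; rewrite /column_class /column_length bv.
    by rewrite inE.
  rewrite [RHS](eq_bigl (fun y => (y \in right_half n x K) && ~~ low_block x y)) => [|v].
    apply: eq_bigr => v /andP[_ /negbTE bv].
    by rewrite /column_class /column_length bv.
  by rewrite inE.
rewrite mulrACA.
have rE : r_ = (x - K.+1 - x./2)%N by exact: card_right_low.
have r'E : r' = (n - K - (x + n.+1)./2)%N by exact: card_right_high.
have M1P : (0 < M1 <= 4)%N by clear -q1; rewrite /M1; lia.
have M2P : (0 < M2 <= 4)%N by clear -q1; rewrite /M2; lia.
have b1 : (2 * r_ <= x)%N by clear -rE; lia.
have b2 : (x <= 2 * r_ + (2 * K + 4))%N by clear -rE; lia.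
have b3 : (2 * r' <= n - x)%N by clear -r'E xn; lia.
have b4 : (n - x <= 2 * r' + (2 * K + 4))%N by clear -r'E xn; lia.
have pos M b r : (0 < M <= 4)%N -> 0 <= class_mass u M ^+ b * T M ^+ r.
  move=> /(class_mass_gt0 u_sq u_lb u_ub) S0; rewrite mulr_ge0 ?exprn_ge0 ?(ltW S0)//.
  by rewrite /T; case: ifP => _//; rewrite divr_ge0 ?exprn_ge0// ltW.
apply: (le_trans (ler_pM (pos _ _ _ M1P) (pos _ _ _ M2P)
  (block_power_le M1P b1 b2) (block_power_le M2P b3 b4))).
rewrite mulrACA -exprD (_ : 2 * K + 4 + (2 * K + 4) = 4 * K + 8)%N; last by clear; lia.
rewrite ler_wpM2l ?exprn_ge0//.
have [q2|q2] := eqVneq q 2%N; rewrite ?q2 ?(negbTE q2) /= in ll.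
  rewrite /M1 /M2 q2 /= expr1n mulr1 ler_wiXn2l ?(ltW r0) ?(ltW r1)//.
  by clear -ll rE; lia.
have -> : (1 < M1)%N by clear -q1 q2; rewrite /M1; lia.
have -> : (1 < M2)%N by clear -q1 q2; rewrite /M2; lia.
rewrite -exprD ler_wiXn2l ?(ltW r0) ?(ltW r1)//.
by clear -ll rE r'E xn; lia.
Qed.

End BlockSum.

(** * Discounting the gaps above a level *)

Section Truncation.
Variables (R : realType) (u z : R).
Hypotheses (u_sq : u ^+ 2 = 1 - u) (u_lb : 618 / 1000 < u)
  (u_ub : u < 6181 / 10000) (z_gt0 : 0 < z) (z_lt1 : z < 1).
Let u_gt0 : 0 < u. Proof. by move: u_lb; lra. Qed.
Let u_lt1 : u < 1. Proof. by move: u_ub; lra. Qed.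
Let z1_gt0 : 0 < 1 - z. Proof. by rewrite subr_gt0. Qed.
Let z1V_ge1 : 1 <= (1 - z)^-1.
Proof. by rewrite invf_ge1// gerBl ltW. Qed.

(* Values above N are penalized by z instead of u. *)
Definition truncated_weight (N j : nat) : R :=
  (0 < j)%N%:R * (u ^+ minn j N * z ^+ (j - N)).

Definition class_of (M j : nat) : 'I_4 := inord (minn j M).-1.

Lemma truncated_weight_ge0 N j : 0 <= truncated_weight N j.
Proof. by rewrite /truncated_weight !mulr_ge0 ?exprn_ge0// ltW. Qed.

Lemma truncated_weightE N j : (0 < j <= N)%N -> truncated_weight N j = u ^+ j.
Proof.
move=> /andP[j0 jN]; rewrite /truncated_weight j0 mul1r (minn_idPl jN).
by move: jN; rewrite -subn_eq0 => /eqP ->; rewrite expr0 mulr1.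
Qed.

Lemma expr_u_step a : u ^+ a.+2 + u ^+ a.+1 = u ^+ a.
Proof. by rewrite -[a.+2]addn2 -[a.+1]addn1 !exprD u_sq expr1; ring. Qed.

Lemma sum_tail_le (f : nat -> R) (M B : nat) (P : pred nat) :
  (forall j, 0 <= f j) -> (forall j, P j -> f j != 0 -> (M <= j)%N) ->
  \sum_(j < B | P j) f j <= \sum_(i < B) f (M + i)%N.
Proof.
move=> f0 PM; pose h j := (M <= j)%N%:R * f j.
apply: (@le_trans _ _ (\sum_(j < B) h j)).
  rewrite big_mkcond; apply: ler_sum => j _; case: ifP => Pj.
    have [->|/(PM _ Pj)] := eqVneq (f j) 0; first by rewrite mulr_ge0.
    by rewrite /h => ->; rewrite mul1r.
  by rewrite mulr_ge0.
apply: (@le_trans _ _ (\sum_(j < M + B) h j)).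
  rewrite [in leRHS]addnC big_split_ord/= lerDl sumr_ge0// => j _.
  by rewrite mulr_ge0.
rewrite big_split_ord/= big1 ?add0r => [|i _].
  by apply: ler_sum => i _; rewrite /h leq_addr mul1r.
by rewrite /h leqNgt ltn_ord mul0r.
Qed.

Lemma truncated_tail N B : (0 < N)%N ->
  \sum_(i < B) truncated_weight N (N + i)%N <= u ^+ N / (1 - z).
Proof.
move=> N0; rewrite (eq_bigr (fun i : 'I_B => u ^+ N * z ^+ i)) => [|i _].
  rewrite -mulr_sumr ler_wpM2l ?exprn_ge0 ?(ltW u_gt0)//.
  by apply: geometric_le; rewrite (ltW z_gt0).
rewrite /truncated_weight addn_gt0 N0 mul1r addKn.
by rewrite (minn_idPr (leq_addr _ _)).
Qed.

(** The full geometric tail from u^(a+2) is u^(a+2) / (1 - u) = u^a; unrolling u^a = u^(a+2) +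
    u^(a+1) up to [N] loses only the factor caused by z. *)
Lemma truncated_tail_below N a B : (a.+2 <= N)%N ->
  \sum_(i < B) truncated_weight N (a.+2 + i)%N <= u ^+ a / (1 - z).
Proof.
elim: B a => [|B IH] a aN.
  by rewrite big_ord0 divr_ge0 ?exprn_ge0// ltW.
have [aN'|aN'] := eqVneq a.+2 N.
  apply: (@le_trans _ _ (u ^+ N / (1 - z))).
    by rewrite aN'; apply: truncated_tail; rewrite -aN'.
  rewrite ler_wpM2r ?invr_ge0 ?(ltW z1_gt0)// -aN'.
  by rewrite ler_wiXn2l ?(ltW u_gt0) ?(ltW u_lt1)// ltnW.
have a3N : (a.+3 <= N)%N by rewrite ltn_neqAle aN'.
rewrite big_ord_recl addn0 truncated_weightE//=.
rewrite -[in leRHS]expr_u_step mulrDl lerD//; last first.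
  apply: le_trans (IH a.+1 a3N); apply: ler_sum => i _.
  by rewrite /bump/= addnA addn1.
by rewrite ler_peMr// exprn_ge0// ltW.
Qed.

(** The last class weight is made for this: for N >= 5 the values from 4 on weigh at most u^2 / (1 -
    z), and for N < 5 the values from N - 1 on weigh at most u^(N-2) / (1 - z). *)
Lemma class_sum N B b : (1 < N)%N ->
  \sum_(j < B | class_of (minn N 5).-1 j == b) truncated_weight N j <=
  (1 - z)^-1 * class_weight u (minn N 5).-1 b.
Proof.
move=> N1; set M := (minn N 5).-1.
have M0 : (0 < M)%N by clear -N1; rewrite /M; lia.
have M4 : (M <= 4)%N by clear; rewrite /M; lia.
have clsE j : class_of M j = (minn j M).-1 :> nat.
  by rewrite inordK//; clear -M4; lia.
rewrite /class_weight; have [bM|bM|bM] := ltngtP b.+1 M.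
- have -> : u ^+ b.+1 = truncated_weight N b.+1.
    by rewrite truncated_weightE//; clear -bM; rewrite /M in bM *; lia.
  apply: (@le_trans _ _ (truncated_weight N b.+1)); last first.
    by rewrite ler_peMl// truncated_weight_ge0.
  apply: (@le_trans _ _ (\sum_(j < B | j == b.+1 :> nat) truncated_weight N j)).
    rewrite big_mkcond [leRHS]big_mkcond; apply: ler_sum => j _.
    case: eqP => [/(congr1 val)/=|_]; last by case: ifP => // _; exact: truncated_weight_ge0.
    rewrite clsE => jb; case: ifP => // /eqP jb'; rewrite /truncated_weight.
    case: (posnP j) => j0; first by rewrite mul0r.
    by exfalso; move: jb jb' bM j0; clear; lia.
  have [bB|bB] := ltnP b.+1 B.
    by rewrite (big_pred1 (Ordinal bB)).
  by rewrite big1 ?truncated_weight_ge0// => j /eqP jb; move: (ltn_ord j); rewrite jb ltnNge bB.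
- rewrite big1 ?mulr0// => j /eqP/(congr1 val)/=.
  by rewrite clsE => jb; exfalso; move: jb bM M0; clear; lia.
apply: (le_trans (@sum_tail_le _ M B (fun j => class_of M j == b) _ _)).
- exact: truncated_weight_ge0.
- move=> j /eqP/(congr1 val)/=; rewrite clsE /truncated_weight => jb.
  case: (posnP j) => [->|j0 _]; first by rewrite mul0r eqxx.
  by move: jb bM j0 M0; clear; lia.
rewrite [leRHS]mulrC; have [N5|N5] := leqP 5 N.
  have -> : M = 4%N by rewrite /M (minn_idPr N5).
  by apply: (@truncated_tail_below N 2); exact: ltnW.
have MN : N = M.+1 by clear -N1 N5; rewrite /M; lia.
case: B => [|B]; first by rewrite big_ord0 divr_ge0 ?exprn_ge0// ltW.
rewrite big_ord_recl addn0 truncated_weightE; last by rewrite M0 MN leqnSn.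
have -> : minn M.-1 2 = M.-1 by clear -N5 MN; lia.
rewrite -[in leRHS]expr_u_step (prednK M0) [in leRHS]addrC mulrDl lerD//.
  by rewrite ler_peMr// exprn_ge0// ltW.
rewrite -MN; apply: le_trans (@truncated_tail N B (ltnW N1)).
apply: ler_sum => i _.
by rewrite /bump/= addnA addn1 -MN.
Qed.

Lemma class_reduction n B (N : 'I_n -> nat) (F : {ffun 'I_n -> 'I_4} -> R) :
  (forall i, (1 < N i)%N) -> (forall a, 0 <= F a) ->
  \sum_(k : {ffun 'I_n -> 'I_B})
    (\prod_i truncated_weight (N i) (k i)) *
    F [ffun i => class_of (minn (N i) 5).-1 (k i)] <=
  (1 - z)^-1 ^+ n *
    \sum_(a : {ffun 'I_n -> 'I_4}) (\prod_i class_weight u (minn (N i) 5).-1 (a i)) * F a.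
Proof.
move=> N1 F0; pose M i := (minn (N i) 5).-1.
rewrite (partition_big (fun k : {ffun 'I_n -> 'I_B} =>
  [ffun i => class_of (M i) (k i)]) predT)//=.
rewrite mulr_sumr; apply: ler_sum => a _.
rewrite (eq_bigr (fun k : {ffun 'I_n -> 'I_B} =>
  (\prod_i truncated_weight (N i) (k i)) * F a)) => [|k /eqP -> //].
rewrite -mulr_suml mulrA ler_wpM2r//.
rewrite -[X in _ ^+ X]card_ord -prodr_const -big_split/=.
apply: (@le_trans _ _ (\prod_i \sum_(j < B | class_of (M i) j == a i)
    truncated_weight (N i) j)); last first.
  apply: ler_prod => i _; rewrite class_sum// andbT sumr_ge0// => j _.
  exact: truncated_weight_ge0.
rewrite bigA_distr_big_dep/= le_eqVlt; apply/orP; left; apply/eqP.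
apply: eq_bigl => k; apply/eqP/familyP => [<- i|ka].
  by rewrite ffunE unfold_in.
by apply/ffunP => i; rewrite ffunE; apply/eqP; have := ka i; rewrite unfold_in.
Qed.

End Truncation.

Definition gaps_above (H : {fset nat}) (e : nat) : nat := (\sum_(y <- H) (e < y))%N.

Lemma sum_ord_geq k N : (\sum_(j < k) (N <= j) = k - N)%N.
Proof.
elim: k => [|k IH]; first by rewrite big_ord0.
by rewrite big_ord_recr/= IH; case: leqP; lia.
Qed.

Section GapsAbove.
Variables (g n : nat) (H : {fset nat}).
Hypotheses (HN : NS g H) (Hm : multiplicity_of n.+1 H).

Lemma gaps_above_vector q x : (x <= n)%N -> (0 < q)%N ->
  gaps_above H (q * n.+1 + x) =
  (\sum_(i < n) (kunz_vector g n H i - column_length x q i))%N.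
Proof.
move=> xn q0; rewrite /gaps_above (sum_gaps_vector HN Hm (fun y => q * n.+1 + x < y : nat)%N).
apply: eq_bigr => i _; rewrite -sum_ord_geq; apply: eq_bigr => j _.
congr nat_of_bool; rewrite /column_length /low_block.
have := ltn_ord i; move: q0 xn; clear; case: q => // q _ xn iN.
case: (leqP i.+1 x) => ix; apply/idP/idP => jq.
- rewrite ltnNge; apply/negP => jq'; move: jq; rewrite ltnNge => /negP; apply.
  by rewrite addnC leq_add// leq_mul2r jq'.
- by have := leq_mul jq (leqnn n.+1); rewrite !mulSn; lia.
- rewrite leqNgt ltnS; apply/negP => jq'.
  by have := leq_mul jq' (leqnn n.+1); move: jq; rewrite !mulSn; lia.
- by have := leq_mul jq (leqnn n.+1); rewrite !mulSn; lia.
Qed.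

Lemma kunz_vector_subadd (i j : 'I_n) q : (i.+1 + j.+1 + q * n.+1)%N \in H ->
  (q < kunz_vector g n H i + kunz_vector g n H j)%N.
Proof.
have [H0 HD gH] := NS_gaps HN; have [_ mH _] := Hm.
by move=> /(kunz_subadd H0 HD _ mH); rewrite !(kunz_vectorE HN Hm); exact.
Qed.

End GapsAbove.

Section DenseBlock.
Variables (R : realType) (u z : R).
Hypotheses (u_sq : u ^+ 2 = 1 - u) (u_lb : 618 / 1000 < u)
  (u_ub : u < 6181 / 10000) (z_gt0 : 0 < z) (z_lt1 : z < 1).

Definition dense_at (K e r : nat) (D : {set 'I_K}) (H : {fset nat}) : Prop :=
  (forall d, d \in D -> (e - d)%N \in H) /\ (gaps_above H e <= r)%N.

(** As at most [r] gaps exceed e, the mass [u ^+ g] of a semigroup is at most [z ^- r] times its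
    product of truncated weights. Its three gaps e - d make every star constraint hold, which brings
    in [block_sum]. *)
Lemma count_dense_at (g n q x K r l : nat) (D : {set 'I_K}) :
  (x <= n)%N -> (1 < q)%N -> #|D| = 3 ->
  (2 * l + 4 * K + 4 <= if q == 2%N then x else n)%N ->
  u ^+ g * count_semigroups R g
    (fun H => multiplicity_of n.+1 H /\ dense_at (q * n.+1 + x) r D H) <=
  z ^- r * (1 - z)^-1 ^+ n * (2 ^+ (4 * K + 8) * star_rate R ^+ l).
Proof.
move=> xn q1 D3 ll.
have u0 : 0 < u by move: u_lb; lra.
pose N i := column_length (n := n) x q i.
have N1 i : (1 < N i)%N by rewrite /N /column_length; case: ifP => _ //; exact: ltnW.
pose F (a : {ffun 'I_n -> 'I_4}) : R :=
  [forall y in right_half n x K, star_ok (column_class x q) (partners x D) y a]%:R.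
pose G (k : {ffun 'I_n -> 'I_g.+1}) : R := z ^- r *
  ((\prod_i truncated_weight u z (N i) (k i)) *
   F [ffun i => class_of (minn (N i) 5).-1 (k i)]).
have tw0 i j : 0 <= truncated_weight u z (N i) j by exact: truncated_weight_ge0.
apply: (@le_trans _ _ (\sum_k G k)).
  apply: count_kunz_le => [k|H HN Hm [HD Hr]].
    by rewrite /G mulr_ge0 ?invr_ge0 ?exprn_ge0 ?(ltW z_gt0)// mulr_ge0// prodr_ge0.
  set k := kunz_vector g n H.
  have k0 i : (0 < k i)%N by exact: kunz_vector_gt0.
  rewrite /G; have -> : F [ffun i => class_of (minn (N i) 5).-1 (k i)] = 1.
    rewrite /F; case: forall_inP => // -[] y yR; apply/forall_inP => c cy.
    have [blk [d dD dE]] := partnersP cy.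
    have clsE i : class_of (minn (N i) 5).-1 (k i) = (minn (k i) (minn (N i) 5).-1).-1 :> nat.
      by rewrite inordK//; clear; lia.
    have aE i : [ffun i => class_of (minn (N i) 5).-1 (k i)] i =
        class_of (minn (N i) 5).-1 (k i) by rewrite ffunE.
    rewrite !aE !clsE /column_class -/(N y).
    have NE : N c = N y by rewrite /N /column_length blk.
    have : (N y <= k c + k y)%N.
      have := HD d dD; move: dE; rewrite /N /column_length /reflection_centre.
      case: ifP => _ dE.
        move=> eH; apply: kunz_vector_subadd => //.
        have -> : (c.+1 + y.+1 + q * n.+1 = q * n.+1 + x - d)%N.
          by rewrite -dE; clear; lia.
        exact: eH.
      move=> eH; rewrite -(ltn_predK q1); apply: (kunz_vector_subadd HN Hm).
      have -> : (c.+1 + y.+1 + q.-1 * n.+1 = q * n.+1 + x - d)%N.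
        rewrite -[in RHS](ltn_predK q1) mulSn; move: dE; move: (_ * _)%N => s; clear; lia.
      exact: eH.
    by rewrite NE; move: (N1 y) (k0 c) (k0 y); clear; lia.
  rewrite mulr1 -{1}(sum_kunz_vector HN Hm) -/k -prodrXr.
  have prodE : \prod_i u ^+ k i * z ^+ gaps_above H (q * n.+1 + x) <=
      \prod_i truncated_weight u z (N i) (k i).
    rewrite (gaps_above_vector HN Hm xn (ltnW q1)) -prodrXr -big_split/=.
    apply: ler_prod => i _; rewrite mulr_ge0 ?exprn_ge0 ?(ltW u0) ?(ltW z_gt0)//=.
    rewrite /truncated_weight k0 mul1r ler_wpM2r ?exprn_ge0 ?(ltW z_gt0)//.
    rewrite ler_wiXn2l ?geq_minl ?(ltW u0)//.
    by move: u_ub; lra.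
  rewrite mulrC ler_pdivlMr ?exprn_gt0//; apply: le_trans prodE.
  rewrite ler_wpM2l ?prodr_ge0// => [i _|]; first by rewrite exprn_ge0// ltW.
  by rewrite ler_wiXn2l ?(ltW z_gt0) ?(ltW z_lt1).
rewrite /G -mulr_sumr -mulrA ler_wpM2l ?invr_ge0 ?exprn_ge0 ?(ltW z_gt0)//.
apply: (le_trans (class_reduction u_sq u_lb u_ub z_gt0 z_lt1 _ _ _)) => //.
rewrite ler_wpM2l ?exprn_ge0 ?invr_ge0 ?subr_ge0 ?(ltW z_lt1)//.
exact: (block_sum u_sq u_lb u_ub xn q1 D3 ll).
Qed.

End DenseBlock.

(** * Deviations of the Kunz coordinates *)

Section ExponentialBounds.
Variable R : realType.

Lemma expR_quadratic_le (y : R) : y <= 1 / 2 -> expR y <= 1 + y + 2 * y ^+ 2.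
Proof.
move=> y2; have y1 : 0 < 1 - y by lra.
apply: (@le_trans _ _ (1 - y)^-1).
  rewrite -[expR y]invrK -expRN lef_pV2 ?posrE ?expR_gt0//.
  by have := expR_ge1Dx (- y).
rewrite -[leLHS]mul1r ler_pdivrMr//.
have -> : (1 + y + 2 * y ^+ 2) * (1 - y) = 1 + y ^+ 2 * (1 - 2 * y) by ring.
by rewrite lerDl mulr_ge0 ?sqr_ge0//; lra.
Qed.

(* The cost of allowing delta * n units of excess is an arbitrarily small
   exponential rate. *)
Lemma penalty_cost (h : R) : 0 < h -> exists z delta : R,
  [/\ 0 < z < 1, 0 < delta & forall n r : nat, r%:R <= delta * n%:R ->
    z ^- r * (1 - z)^-1 ^+ n <= expR (h * n%:R)].
Proof.
move=> h0; pose z := 1 - expR (- (h / 2)).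
have e1 : 0 < expR (- (h / 2)) < 1.
  by rewrite expR_gt0 expR_lt1 oppr_lt0 divr_gt0.
have z01 : 0 < z < 1 by move: e1; rewrite /z; lra.
have [z0 z1] := andP z01.
have lnz : 0 < - ln z by rewrite oppr_gt0 ln_lt0.
exists z, (h / 2 / - ln z); split=> // [|n r rn]; first by rewrite !divr_gt0.
have -> : z ^- r = expR (r%:R * - ln z).
  by rewrite expRM_natl expRN lnK ?posrE// exprVn.
have -> : (1 - z)^-1 ^+ n = expR (n%:R * (h / 2)).
  by rewrite expRM_natl /z opprB addrC subrK -expRN opprK.
rewrite -expRD ler_expR.
have : r%:R * - ln z <= h / 2 * n%:R.
  by rewrite -ler_pdivlMr//; apply: le_trans rn _; rewrite mulrAC.
lra.
Qed.

End ExponentialBounds.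

Section Deviation.
Variables (R : realType) (u z : R).
Hypotheses (u_sq : u ^+ 2 = 1 - u) (u_lb : 618 / 1000 < u)
  (u_ub : u < 6181 / 10000) (z_gt0 : 0 < z) (z_lt1 : z < 1).

Definition deviation (g n : nat) (v : 'I_n -> R) (H : {fset nat}) : R :=
  \sum_i v i * ((1 < kunz_vector g n H i)%N%:R - u ^+ 2).

(** The bound on a moment generating function in Chernoff's method. Up to the factor 1 / (1 - z),
    the value 1 has mass u and the values from 2 on have mass u^2, so the first-order terms -u^3 and
    u^3 cancel. *)
Lemma tilted_sum (s v : R) g : 0 < s <= 1 / 2 -> `|v| <= 1 ->
  \sum_(j < g.+1) truncated_weight u z 2 j * expR (s * (v * ((1 < j)%N%:R - u ^+ 2)))
  <= (1 - z)^-1 * expR (2 * s ^+ 2).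
Proof.
move=> /andP[s0 s2] v1.
have u0 : 0 < u by move: u_lb; lra.
have u1 : u < 1 by move: u_ub; lra.
have z1 : 0 < 1 - z by rewrite subr_gt0.
have z1V : 1 <= (1 - z)^-1 by rewrite invf_ge1// gerBl ltW.
have tw0 j : 0 <= truncated_weight u z 2 j.
  exact: truncated_weight_ge0.
apply: (le_trans (@ler_sum_ord_recl2 _ (fun j => truncated_weight u z 2 j *
  expR (s * (v * ((1 < j)%N%:R - u ^+ 2)))) g _)) => [j|].
  by rewrite mulr_ge0 ?expR_ge0.
rewrite {1}/truncated_weight !mul0r add0r truncated_weightE// expr1 /=.
rewrite -mulr_suml.
have tail : \sum_(j < g) truncated_weight u z 2 j.+2 <= u ^+ 2 / (1 - z).
  by apply: (truncated_tail u_lb z_gt0 z_lt1 g (N := 2)).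
apply: (@le_trans _ _ ((1 - z)^-1 * (u * expR (s * (v * (0 - u ^+ 2)))
    + u ^+ 2 * expR (s * (v * (1 - u ^+ 2)))))).
  rewrite [leRHS]mulrDr lerD//.
    by rewrite ler_peMl// mulr_ge0 ?expR_ge0// ltW.
  by rewrite [leRHS]mulrA ler_wpM2r ?expR_ge0// [leRHS]mulrC.
rewrite ler_wpM2l ?invr_ge0 ?(ltW z1)//.
have u21 : 1 - u ^+ 2 = u by rewrite u_sq; ring.
rewrite u21 sub0r.
have sv : `|s * v| <= 1 / 2.
  rewrite normrM (gtr0_norm s0); apply: le_trans s2.
  by rewrite ler_piMr// ltW.
have bound (c : R) : `|c| <= 1 -> s * (v * c) <= 1 / 2.
  move=> c1; apply: (le_trans (ler_norm _)).
  by rewrite mulrA normrM; apply: le_trans sv; rewrite ler_piMr.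
apply: (@le_trans _ _ (1 + 2 * s ^+ 2)); last exact: expR_ge1Dx.
have u_norm : `|u| <= 1 by rewrite gtr0_norm// ltW.
have u2_norm : `|- u ^+ 2| <= 1 by rewrite normrN normrX exprn_ile1.
have e1 := expR_quadratic_le (bound _ u2_norm).
have e2 := expR_quadratic_le (bound _ u_norm).
apply: (@le_trans _ _ (u * (1 + s * (v * - u ^+ 2) + 2 * (s * (v * - u ^+ 2)) ^+ 2)
  + u ^+ 2 * (1 + s * (v * u) + 2 * (s * (v * u)) ^+ 2))).
  by rewrite lerD// ler_wpM2l// ?sqr_ge0// ltW.
have -> : u * (1 + s * (v * - u ^+ 2) + 2 * (s * (v * - u ^+ 2)) ^+ 2)
  + u ^+ 2 * (1 + s * (v * u) + 2 * (s * (v * u)) ^+ 2) =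
  (u ^+ 2 + u) + 2 * (s ^+ 2 * (v ^+ 2 * (u ^+ 3 * (u ^+ 2 + u)))) by ring.
rewrite u_sq subrK mulr1 lerD2l ler_pM2l// ler_piMr ?sqr_ge0//.
rewrite mulr_ile1 ?sqr_ge0 ?exprn_ge0 ?(ltW u0)//; last by rewrite exprn_ile1 ?ltW.
by rewrite -real_normK ?num_real// exprn_ile1.
Qed.

Lemma count_deviation (g n r : nat) (v : 'I_n -> R) (s d : R) :
  0 < s <= 1 / 2 -> (forall i, `|v i| <= 1) ->
  u ^+ g * count_semigroups R g (fun H => multiplicity_of n.+1 H /\
    ((gaps_above H (2 * n.+1) <= r)%N /\ d <= deviation g v H)) <=
  z ^- r * (1 - z)^-1 ^+ n * expR (2 * s ^+ 2 * n%:R - s * d).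
Proof.
move=> s12 v1; have [s0 s2] := andP s12.
have u0 : 0 < u by move: u_lb; lra.
pose w i j := truncated_weight u z 2 j * expR (s * (v i * ((1 < j)%N%:R - u ^+ 2))).
have tw0 j : 0 <= truncated_weight u z 2 j by exact: truncated_weight_ge0.
have w0 i j : 0 <= w i j by rewrite mulr_ge0 ?expR_ge0.
pose G (k : {ffun 'I_n -> 'I_g.+1}) := z ^- r * expR (- (s * d)) * \prod_i w i (k i).
apply: (@le_trans _ _ (\sum_k G k)); last first.
  rewrite -mulr_sumr (sum_prod_ffun (fun i (j : 'I_g.+1) => w i j)).
  rewrite expRD; set A := expR (2 * _ * _); set B := expR (- _).
  have -> : z ^- r * (1 - z)^-1 ^+ n * (A * B) = z ^- r * (B * ((1 - z)^-1 ^+ n * A)).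
    by ring.
  rewrite -mulrA ler_wpM2l ?invr_ge0 ?exprn_ge0 ?(ltW z_gt0)//.
  rewrite ler_wpM2l ?expR_ge0//.
  rewrite {}/A expRM_natr -exprMn -[X in _ ^+ X]card_ord -prodr_const.
  apply: ler_prod => i _; rewrite sumr_ge0//=; exact: tilted_sum.
apply: count_kunz_le => [k|H HN Hm [Hr Hd]].
  by rewrite !mulr_ge0 ?expR_ge0 ?invr_ge0 ?exprn_ge0 ?(ltW z_gt0)// prodr_ge0.
set k := kunz_vector g n H.
rewrite /G big_split/= -expR_sum -mulr_sumr -/(deviation g v H).
rewrite mulrACA -expRD.
apply: (@le_trans _ _ (z ^- r * \prod_i truncated_weight u z 2 (k i))); last first.
  rewrite ler_peMr// ?mulr_ge0 ?prodr_ge0 ?invr_ge0 ?exprn_ge0 ?(ltW z_gt0)//.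
  by rewrite -expR0 ler_expR addrC subr_ge0 ler_pM2l.
have k0 i : (0 < k i)%N by exact: kunz_vector_gt0.
rewrite mulrC ler_pdivlMr ?exprn_gt0//.
rewrite -{1}(sum_kunz_vector HN Hm) -/k -prodrXr.
apply: (@le_trans _ _ (\prod_i u ^+ k i * z ^+ gaps_above H (2 * n.+1))).
  rewrite ler_wpM2l ?prodr_ge0// => [i _|]; first by rewrite exprn_ge0// ltW.
  by rewrite ler_wiXn2l ?(ltW z_gt0) ?(ltW z_lt1).
have := gaps_above_vector HN Hm (q := 2) (x := 0) (leq0n n) isT.
rewrite addn0 => ->; rewrite -prodrXr -big_split/=.
apply: ler_prod => i _; rewrite mulr_ge0 ?exprn_ge0 ?(ltW u0) ?(ltW z_gt0)//=.
rewrite /truncated_weight k0 mul1r /column_length /low_block /=.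
rewrite ler_wpM2r ?exprn_ge0 ?(ltW z_gt0)//.
rewrite ler_wiXn2l ?geq_minl ?(ltW u0)//.
by move: u_ub; lra.
Qed.

(** A base larger than u gains exponentially over [u ^+ g]; with 2/3 the sum over all values j >= 1
    is exactly 2. *)
Lemma count_multiplicity (g n : nat) :
  (2 / 3) ^+ g * count_semigroups R g (fun H => multiplicity_of n.+1 H /\ True) <= 2 ^+ n.
Proof.
pose w (j : nat) : R := (0 < j)%N%:R * (2 / 3) ^+ j.
have w0 j : 0 <= w j by rewrite mulr_ge0// exprn_ge0// divr_ge0.
apply: (@le_trans _ _ (\sum_(k : {ffun 'I_n -> 'I_g.+1}) \prod_i w (k i))).
  apply: count_kunz_le => [k|H HN Hm _]; first exact: prodr_ge0.
  rewrite -{1}(sum_kunz_vector HN Hm) -prodrXr; apply: ler_prod => i _.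
  rewrite exprn_ge0 ?divr_ge0//= /w kunz_vector_gt0// mul1r//.
rewrite (sum_prod_ffun (fun _ (j : 'I_g.+1) => w j)) prodr_const card_ord.
have s0 : 0 <= \sum_(j < g.+1) w j by rewrite sumr_ge0.
rewrite lerXn2r ?nnegrE//.
rewrite big_ord_recl {1}/w mul0r add0r.
rewrite (eq_bigr (fun j : 'I_g => (2 / 3) * (2 / 3) ^+ j)) => [|j _].
  rewrite -mulr_sumr; have : \sum_(i < g) (2 / 3 : R) ^+ i <= (1 - 2 / 3)^-1.
    by apply: geometric_le; lra.
  have -> : (1 - 2 / 3 : R)^-1 = 3 by field.
  by lra.
by rewrite /w mul1r -exprS.
Qed.

End Deviation.

(** * Locating three neighbouring gaps with few gaps above them *)

Section DenseBlockExists.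
Variables (g n : nat) (H : {fset nat}) (K : nat).
Hypotheses (HN : NS g H) (K_gt0 : (0 < K)%N).

Let block_size J := (\sum_(y <- H) (y %/ K == J))%N.

Let block_bound J0 : (forall J, J0 <= J -> block_size J < 3)%N ->
  (\sum_(y <- H) (J0 <= y %/ K) <= 3 * (2 * g %/ K).+1)%N.
Proof.
move=> small; have [_ HD gH] := NS_gaps HN.
apply: (@leq_trans (\sum_(J < (2 * g %/ K).+1) if (J0 <= J)%N then block_size J else 0)%N).
  rewrite -[leqRHS]big_mkcond/= /block_size exchange_big/= big_seq [leqRHS]big_seq; apply: leq_sum => y yH.
  have yg : (y %/ K < (2 * g %/ K).+1)%N.
    by rewrite ltnS leq_div2r// ltnW// -gH gap_lt.
  have [Jy|//] := leqP J0 (y %/ K); rewrite (bigD1 (Ordinal yg))//= eqxx//.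
apply: (@leq_trans (\sum_(J < (2 * g %/ K).+1) 3)%N); last first.
  by rewrite sum_nat_const card_ord mulnC.
apply: leq_sum => J _.
by case: ifP => // /small /ltnW.
Qed.

Let big_block J : (3 <= block_size J)%N ->
  exists2 D : {set 'I_K}, #|D| = 3 & forall d, d \in D -> ((J.+1 * K).-1 - d)%N \in H.
Proof.
move=> J3; pose A : {set 'I_K} := [set d : 'I_K | ((J.+1 * K).-1 - d)%N \in H]%SET.
have A3 : (3 <= #|A|)%N.
  apply: leq_trans J3 _; rewrite /block_size -big_mkcond/= sum1_count -size_filter.
  set s := seq.filter _ _.
  have lt_K y : (K.-1 - y %% K < K)%N by move: K_gt0; clear; lia.
  pose h y : 'I_K := Ordinal (lt_K y).
  have sP y : y \in s -> y \in H /\ ((J.+1 * K).-1 - h y = y)%N.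
    rewrite mem_filter => /andP[/eqP yJ yH]; split=> //=.
    have := divn_eq y K; rewrite yJ mulSn; have := ltn_pmod y K_gt0.
    by move: K_gt0; move: (y %% K)%N (J * K)%N; clear; lia.
  rewrite -(size_map h) cardE; apply: uniq_leq_size.
    rewrite map_inj_in_uniq ?filter_uniq ?fset_uniq// => y y' /sP[_ e] /sP[_ e'] hh.
    by rewrite -e -e' hh.
  by move=> _ /mapP[y /sP[yH e] ->]; rewrite mem_enum inE e.
have [s [us s3 sA]] := card_geqP A3.
exists [set x in s]%SET; first by rewrite cardsE (card_uniqP us).
by move=> d; rewrite inE => /sA; rewrite inE.
Qed.

(** If no block qualified, at most [s] gaps would lie in the margin above [2 * n.+1] and fewer than
    three in each block after it. The margin matters when the block ends below three times the
    multiplicity: only the low classes are then constrained, and there are at least [s] of them. *)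
Lemma dense_block_exists s : (s + 3 * (2 * g %/ K).+1 < gaps_above H (2 * n.+1))%N ->
  exists (J : 'I_(2 * g %/ K).+1) (D : {set 'I_K}),
   [/\ #|D| = 3, (2 * n.+1 + s <= (J.+1 * K).-1)%N
     & dense_at (J.+1 * K).-1 (3 * (2 * g %/ K).+1) D H].
Proof.
move=> many; have [H0 HD gH] := NS_gaps HN.
have gap_block J : (2 * g %/ K < J)%N -> block_size J = 0%N.
  move=> JK; rewrite /block_size big_seq big1// => y yH.
  case: eqP => // yJ; exfalso; move: JK; rewrite -yJ ltnNge => /negP; apply.
  by rewrite leq_div2r// ltnW// -gH gap_lt.
have ex : exists J, (3 <= block_size J)%N && (2 * n.+1 + s <= (J.+1 * K).-1)%N.
  apply: contrapT => nex; move: many; rewrite ltnNge => /negP; apply.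
  pose J0 := ((2 * n.+1 + s) %/ K)%N.
  have small J : (J0 <= J -> block_size J < 3)%N.
    move=> J0J; rewrite ltnNge; apply/negP => J3; apply: nex; exists J.
    rewrite J3/=; have : (2 * n.+1 + s < J.+1 * K)%N.
      by rewrite -ltn_divLR// ltnS.
    by case: (J.+1 * K)%N.
  apply: leq_trans (leq_add (leqnn s) (block_bound small)).
  rewrite /gaps_above; apply: (@leq_trans
    (\sum_(y <- H) ((2 * n.+1 < y <= 2 * n.+1 + s) + (J0 <= y %/ K)))%N).
    apply: leq_sum => y _; case: (leqP y (2 * n.+1 + s)) => ys.
      by rewrite andbT leq_addr.
    have -> : (J0 <= y %/ K)%N by rewrite leq_div2r// ltnW.
    by rewrite addn1; case: (_ < _)%N.
  rewrite big_split/= leq_add2r -big_mkcond sum1_count -size_filter.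
  rewrite -[leqRHS](size_iota (2 * n.+1).+1 s); apply: uniq_leq_size.
    by rewrite filter_uniq ?fset_uniq.
  by move=> y; rewrite mem_filter mem_iota addSn ltnS => /andP[].
have bounded J : (3 <= block_size J)%N && (2 * n.+1 + s <= (J.+1 * K).-1)%N ->
    (J <= 2 * g %/ K)%N.
  by move=> /andP[J3 _]; rewrite leqNgt; apply/negP => /gap_block J0; rewrite J0 in J3.
case: (ex_maxnP ex bounded) => J /andP[J3 Js] Jmax.
have JN : (J < (2 * g %/ K).+1)%N by rewrite ltnS bounded// J3.
have [D D3 DH] := big_block J3.
exists (Ordinal JN), D; split=> //; split=> //=.
apply: leq_trans (block_bound (J0 := J.+1) _); last first.
  move=> J' JJ'; rewrite ltnNge; apply/negP => J'3.
  suff : (J' <= J)%N by rewrite leqNgt JJ'.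
  apply: Jmax; rewrite J'3 (leq_trans Js)//.
  by rewrite -!subn1 leq_sub2r// leq_mul2r ltnS ltnW ?orbT.
apply: leq_sum => y _; rewrite leq_divRL//.
by rewrite prednK// muln_gt0.
Qed.

End DenseBlockExists.

Section ManyGaps.
Variables (R : realType) (u z : R).
Hypotheses (u_sq : u ^+ 2 = 1 - u) (u_lb : 618 / 1000 < u)
  (u_ub : u < 6181 / 10000) (z_gt0 : 0 < z) (z_lt1 : z < 1).

(** A union bound over the block and its three offsets. The number of offset sets is at most
    [2 ^ K], a constant because K will not depend on g. *)
Lemma count_many_gaps (g n s K r l : nat) : (0 < K)%N ->
  r = (3 * (2 * g %/ K).+1)%N ->
  (2 * l + 4 * K + 4 <= s)%N -> (s <= n)%N ->
  u ^+ g * count_semigroups R g (fun H => multiplicity_of n.+1 H /\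
    (s + r < gaps_above H (2 * n.+1))%N) <=
  ((2 * g).+1 * 2 ^ K)%N%:R *
  (z ^- r * (1 - z)^-1 ^+ n * (2 ^+ (4 * K + 8) * star_rate R ^+ l)).
Proof.
move=> K0 rE ls sn.
have u0 : 0 < u by move: u_lb; lra.
have [rho0 rho1] := andP (star_rate_bounds R).
set B := (X in _ <= _ * X).
have B0 : 0 <= B.
  rewrite /B !mulr_ge0 ?invr_ge0 ?exprn_ge0 ?invr_ge0 ?(ltW rho0) ?(ltW z_gt0)//.
  by rewrite subr_ge0 ltW.
pose Q (JD : 'I_(2 * g %/ K).+1 * {set 'I_K}) (H : {fset nat}) : Prop :=
  [/\ #|JD.2| = 3, (2 * n.+1 + s <= (JD.1.+1 * K).-1)%N
     & multiplicity_of n.+1 H /\ dense_at (JD.1.+1 * K).-1 r JD.2 H].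
apply: (@le_trans _ _ (u ^+ g * \sum_JD count_semigroups R g (Q JD))).
  rewrite ler_wpM2l ?exprn_ge0 ?(ltW u0)//; apply: count_semigroups_bigcup.
  rewrite rE => H HN [Hm /(dense_block_exists HN K0)[J [D [D3 JDs dense]]]].
  by exists (J, D); split=> //; rewrite rE.
rewrite mulr_sumr; apply: (@le_trans _ _ (\sum_(JD : 'I_(2 * g %/ K).+1 * {set 'I_K}) B)).
  apply: ler_sum => -[J D] _.
  have [[D3 Js]|nJD] := pselect (#|D| = 3 /\ (2 * n.+1 + s <= (J.+1 * K).-1)%N); last first.
    rewrite /count_semigroups big1 ?mulr0// => H _.
    by case: asboolP => // -[D3 Js _]; exfalso; apply: nJD.
  set e := (J.+1 * K).-1 in Js *; have eE := divn_eq e n.+1.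
  have xn : (e %% n.+1 <= n)%N by rewrite -ltnS ltn_mod.
  have q1 : (1 < e %/ n.+1)%N by rewrite leq_divRL// (leq_trans _ Js)// leq_addr.
  apply: le_trans (count_dense_at u_sq u_lb u_ub z_gt0 z_lt1 g r (l := l) xn q1 D3 _).
    rewrite ler_wpM2l ?exprn_ge0 ?(ltW u0)//.
    by apply: ler_count_semigroups => H _ [_ _ [Hm]]; rewrite -eE.
  case: eqP => [q2|_]; last exact: leq_trans ls sn.
  by apply: leq_trans ls _; move: eE Js; rewrite q2; clear; lia.
rewrite sumr_const -[leLHS]mulr_natl ler_wpM2r// ler_nat.
rewrite card_prod card_ord -cardsT -powersetT card_powerset cardsT card_ord.
by rewrite leq_mul2r ltnS leq_div orbT.
Qed.

End ManyGaps.

(** * Exponentially small families of semigroups *)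

Lemma two_expr10_lt1 (R : realType) (x : R) :
  0 <= x -> x <= 9272 / 10000 -> 2 * x ^+ 10 < 1.
Proof.
move=> x0 x1.
have sq_le (a b : R) : 0 <= a -> a <= b -> a ^+ 2 <= b * b.
  by move=> a0 ab; rewrite expr2 ler_pM.
have x2 : x ^+ 2 <= 86 / 100 by apply: le_trans (sq_le _ _ x0 x1) _; lra.
have x4 : x ^+ 4 <= 74 / 100.
  have -> : x ^+ 4 = (x ^+ 2) ^+ 2 by rewrite -exprM.
  by apply: le_trans (sq_le _ _ (sqr_ge0 x) x2) _; lra.
have x40 : 0 <= x ^+ 4 by rewrite exprn_ge0.
have x8 : x ^+ 8 <= 55 / 100.
  have -> : x ^+ 8 = (x ^+ 4) ^+ 2 by rewrite -exprM.
  by apply: le_trans (sq_le _ _ x40 x4) _; lra.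
have x80 : 0 <= x ^+ 8 by rewrite exprn_ge0.
have x10 := ler_pM x80 (sqr_ge0 x) x8 x2; rewrite -exprD in x10.
apply: (@le_lt_trans _ _ (2 * (55 / 100 * (86 / 100)))); last by lra.
by rewrite ler_wpM2l// ler0n.
Qed.

Section ExponentialDecay.
Variables (R : realType) (u : R).
Hypotheses (u_sq : u ^+ 2 = 1 - u) (u_lb : 618 / 1000 < u)
  (u_ub : u < 6181 / 10000).
Let u_gt0 : 0 < u. Proof. by move: u_lb; lra. Qed.

Lemma small_multiplicity_decay : exists2 tau : R, 0 < tau &
  forall g n : nat, (10 * n.+1 <= g)%N ->
    u ^+ g * count_semigroups R g (fun H => multiplicity_of n.+1 H /\ True)
    <= expR (- (tau * g%:R)).
Proof.
(* The base 2/3 saves a factor [x] for each unit of genus, while a factor 2 is paid at most once for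
   every ten units. *)
pose x := 3 / 2 * u; pose y := 2 * x ^+ 10.
have x_bd : 0 < x < 9272 / 10000 by rewrite /x; move: u_lb u_ub; lra.
have [x0 x1] := andP x_bd.
have y0 : 0 < y by rewrite mulr_gt0// exprn_gt0.
have y1 : y < 1 by apply: two_expr10_lt1; exact: ltW.
have lny : 0 < - ln y by rewrite oppr_gt0 ln_lt0// y0.
exists (- ln y / 10); first by rewrite divr_gt0.
move=> g n ng; set c := count_semigroups _ _ _.
have c_le := count_multiplicity R g n; rewrite -/c in c_le.
have c0 : 0 <= c by exact: count_semigroups_ge0.
have -> : u ^+ g * c = x ^+ g * ((2 / 3) ^+ g * c).
  by rewrite mulrA -exprMn /x; congr (_ ^+ _ * _); field.
apply: (@le_trans _ _ (x ^+ g * 2 ^+ n)); first by rewrite ler_wpM2l// exprn_ge0// ltW.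
rewrite -(@ler_pXn2r _ 10)// ?nnegrE ?expR_ge0//; last first.
  by rewrite mulr_ge0 ?exprn_ge0// ltW.
have -> : expR (- (- ln y / 10 * g%:R)) ^+ 10 = y ^+ g.
  rewrite -expRM_natl (_ : _ * _ = g%:R * ln y); last by field.
  by rewrite expRM_natl lnK.
have -> : (x ^+ g * 2 ^+ n) ^+ 10 = 2 ^+ (n * 10) * x ^+ (g * 10).
  by rewrite exprMn -!exprM mulrC.
have -> : y ^+ g = 2 ^+ g * x ^+ (g * 10) by rewrite /y exprMn -exprM mulnC.
rewrite ler_wpM2r ?exprn_ge0 ?(ltW x0)//.
by rewrite ler_weXn2l ?ler1n//; move: ng; clear; lia.
Qed.

Lemma deviation_decay (eta : R) : 0 < eta <= 1 ->
  exists P0 : nat, exists2 tau : R, 0 < tau &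
  forall (P g n : nat) (v : 'I_n -> R), (P0 <= P)%N -> (0 < P)%N ->
    (forall i, `|v i| <= 1) ->
    u ^+ g * count_semigroups R g (fun H => multiplicity_of n.+1 H /\
      ((P * gaps_above H (2 * n.+1) <= n)%N /\ eta * n%:R <= deviation u g v H))
    <= expR (- (tau * n%:R)).
Proof.
move=> /andP[eta0 eta1].
(* With s = eta / 4 the Chernoff exponent per coordinate is eta^2 / 8 - eta^2 / 4 = -eta^2 / 8; half
   of this gain is granted to the penalty. *)
have h0 : 0 < eta ^+ 2 / 16 by rewrite divr_gt0// exprn_gt0.
have [z [delta [/andP[z0 z1] delta0 zP]]] := penalty_cost h0.
exists (Num.bound (delta^-1)), (eta ^+ 2 / 16) => // P g n v P0 P1 v1.
have dP : delta^-1 < P%:R.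
  apply: (@lt_le_trans _ _ (Num.bound delta^-1)%:R); last by rewrite ler_nat.
  by apply: archi_boundP; rewrite invr_ge0 ltW.
have PR : (0 : R) < P%:R by rewrite ltr0n.
have rn : (n %/ P)%:R <= delta * n%:R.
  apply: (@le_trans _ _ (n%:R / P%:R)).
    by rewrite ler_pdivlMr// -natrM ler_nat leq_trunc_div.
  rewrite mulrC ler_wpM2r ?ler0n// -[leRHS]invrK lef_pV2 ?posrE ?invr_gt0//.
  exact: ltW.
have := count_deviation u_sq u_lb u_ub z0 z1 g (n %/ P) (v := v)
  (s := eta / 4) (eta * n%:R).
rewrite divr_gt0//= => /(_ _ v1) cd.
apply: (le_trans (y := expR (eta ^+ 2 / 16 * n%:R) *
   expR (2 * (eta / 4) ^+ 2 * n%:R - eta / 4 * (eta * n%:R)))).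
  apply: le_trans (ler_wpM2r (expR_ge0 _) (zP n (n %/ P)%N rn)).
  apply: le_trans (cd _); last by move: eta1; lra.
  rewrite ler_wpM2l ?exprn_ge0 ?(ltW u_gt0)//.
  apply: ler_count_semigroups => H _ [Hm [HP Hd]]; split=> //; split=> //.
  by rewrite leq_divRL// mulnC.
rewrite -expRD ler_expR le_eqVlt; apply/orP; left; apply/eqP; by field.
Qed.

Lemma many_gaps_decay (P : nat) : (0 < P)%N ->
  exists C tau : R, exists n0 : nat, [/\ 0 < C, 0 < tau &
  forall g n : nat, (n0 <= n)%N -> (g <= 10 * n.+1)%N ->
    u ^+ g * count_semigroups R g (fun H => multiplicity_of n.+1 H /\
      (n < P * gaps_above H (2 * n.+1))%N)
    <= C * (2 * g).+1%:R * expR (- (tau * n%:R))].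
Proof.
move=> P0; have [rho0 rho1] := andP (star_rate_bounds R).
pose lam : R := - ln (star_rate R).
have lam0 : 0 < lam by rewrite oppr_gt0 ln_lt0// rho0.
have PR : (0 : R) < P%:R by rewrite ltr0n.
have P16 : (0 : R) < 16 * P%:R by rewrite mulr_gt0.
(* The stars will gain [lam * l] with [l] about n / (8 P); the penalty may spend half of it. *)
have h0 : 0 < lam / (16 * P%:R) by rewrite divr_gt0.
have [z [delta [/andP[z0 z1] delta0 zP]]] := penalty_cost h0.
(* The second bound keeps [r] at most n / (4 P); with [s] at most n / (2 P), the sum [s + r] does
   not exceed n / P. *)
pose del : R := Num.min delta (4 * P%:R)^-1.
have del0 : 0 < del by rewrite lt_min delta0 invr_gt0 mulr_gt0.
have del_delta : del <= delta by rewrite ge_min lexx.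
have del_P : del <= (4 * P%:R)^-1 by rewrite ge_min lexx orbT.
(* As g <= 10 (n + 1), this gives 3 (2 g / K) <= del (n + 1) / 4; the remaining 3 in [r] is at most
   del n / 2 once n >= 6 / del, which is the purpose of [n1]. *)
pose K := Num.bound (240 / del).
have KR : 240 / del < K%:R by apply: archi_boundP; rewrite divr_ge0 ?ler0n// ltW.
have K0 : (0 < K)%N by rewrite -(ltr_nat R); apply: lt_trans KR; rewrite divr_gt0 ?ltr0n.
pose n1 := Num.bound (6 / del).
have n1R : 6 / del < n1%:R by apply: archi_boundP; rewrite divr_ge0 ?ler0n// ltW.
pose n0 := (n1 + 4 * P * (4 * K + 6))%N.
exists (2 ^+ K * 2 ^+ (4 * K + 8) * expR lam), (lam / (16 * P%:R)), n0.
split=> // [|g n n0n gn].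
  by rewrite !mulr_gt0 ?exprn_gt0 ?expR_gt0.
pose r := (3 * (2 * g %/ K).+1)%N.
have rn : r%:R <= del * n%:R.
  have n1n : n1%:R <= n%:R :> R by rewrite ler_nat (leq_trans _ n0n)// leq_addr.
  have n6 : 6 <= del * n%:R.
    by rewrite mulrC -ler_pdivrMr// (le_trans (ltW n1R)).
  have gK : (2 * g %/ K)%:R <= del * n.+1%:R / 12 :> R.
    apply: (@le_trans _ _ ((20 * n.+1)%:R / K%:R)).
      rewrite ler_pdivlMr ?ltr0n// -natrM ler_nat.
      by apply: leq_trans (leq_trunc_div _ _) _; move: gn; clear; lia.
    rewrite ler_pdivrMr ?ltr0n// natrM.
    have : 240 <= del * K%:R by rewrite mulrC -ler_pdivrMr// ltW.
    move: (ler0n R n.+1); move: (n.+1%:R) (K%:R) => a b a0 ab; nra.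
  rewrite /r natrM -natr1; rewrite -natr1 mulrDr mulr1 in gK.
  have d1 : del <= 1.
    apply: (le_trans del_P); rewrite invf_le1 ?mulr_gt0//.
    by rewrite -natrM ler1n muln_gt0 P0.
  by move: gK n6 d1; lra.
pose s := (n %/ (2 * P))%N; pose l := (n %/ (8 * P))%N.
have P2 : (0 < 2 * P)%N by rewrite muln_gt0.
have P8 : (0 < 8 * P)%N by rewrite muln_gt0.
have sn : (s * (2 * P) <= n)%N by exact: leq_trunc_div.
have ns : (n < s.+1 * (2 * P))%N by exact: ltn_ceil.
have ln : (l * (8 * P) <= n)%N by exact: leq_trunc_div.
have nl : (n < l.+1 * (8 * P))%N by exact: ltn_ceil.
have ls : (2 * l + 4 * K + 4 <= s)%N.
  have n0n' : (4 * P * (4 * K + 6) <= n)%N by rewrite (leq_trans _ n0n)// leq_addl.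
  have : (P * (8 * l + 4 * (4 * K + 6)) <= P * (4 * s.+1))%N.
    by move: n0n' ns ln; clear; nia.
  by rewrite leq_mul2l; case/orP => [/eqP P_eq0|]; [by rewrite P_eq0 in P0|clear; lia].
have s_n : (s <= n)%N by exact: leq_div.
have r4 : (4 * P * r <= n)%N.
  rewrite -(ler_nat R) natrM mulrC natrM -ler_pdivlMr ?mulr_gt0//.
  by rewrite mulrC (le_trans rn)// ler_wpM2r.
have rdelta : r%:R <= delta * n%:R by rewrite (le_trans rn)// ler_wpM2r.
apply: (@le_trans _ _ (((2 * g).+1 * 2 ^ K)%N%:R *
  (z ^- r * (1 - z)^-1 ^+ n * (2 ^+ (4 * K + 8) * star_rate R ^+ l)))).
  apply: le_trans (count_many_gaps u_sq u_lb u_ub z0 z1 K0 (erefl r) ls s_n).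
  rewrite ler_wpM2l ?exprn_ge0 ?(ltW u_gt0)//.
  apply: ler_count_semigroups => H _ [Hm HP]; split=> //.
  rewrite -(ltn_pmul2l P0); apply: leq_ltn_trans HP.
  by move: sn r4; clear; nia.
apply: (@le_trans _ _ (((2 * g).+1 * 2 ^ K)%N%:R *
  (expR (lam / (16 * P%:R) * n%:R) *
   (2 ^+ (4 * K + 8) * (expR lam * expR (- (lam / (8 * P%:R) * n%:R))))))).
  rewrite ler_wpM2l//; apply: ler_pM => //.
  - by rewrite mulr_ge0 ?invr_ge0 ?exprn_ge0 ?invr_ge0 ?(ltW z0)// subr_ge0 ltW.
  - by rewrite mulr_ge0 ?exprn_ge0 ?(ltW rho0).
  - exact: zP.
  rewrite ler_wpM2l ?exprn_ge0// -expRD.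
  have -> : star_rate R ^+ l = expR (- (lam * l%:R)).
    by rewrite /lam mulNr opprK expRM_natr lnK.
  have nlR : n%:R <= (l%:R + 1) * (8 * P%:R) :> R.
    by rewrite natr1 -!natrM ler_nat ltnW.
  have key : lam * (n%:R / (8 * P%:R)) <= lam * (l%:R + 1).
    by rewrite ler_wpM2l ?(ltW lam0)// ler_pdivrMr// mulr_gt0.
  by rewrite ler_expR mulrAC -mulrA; lra.
rewrite natrM natrX le_eqVlt; apply/orP; left; apply/eqP.
have -> : expR (- (lam / (16 * P%:R) * n%:R)) =
    expR (lam / (16 * P%:R) * n%:R) * expR (- (lam / (8 * P%:R) * n%:R)).
  by rewrite -expRD; congr expR; field; rewrite gt_eqF.
ring.
Qed.

End ExponentialDecay.

(** * The weight in terms of the Kunz coordinates *)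

(* With theta = D1 + G and c = u / 10 + 1/2, the main terms cancel because
   c (2 - u)^2 = (4 - 3 u) / 2. *)
Lemma weight_error_bound (R : realType) (u eta g n D1 D2 G rest : R) :
  u ^+ 2 = 1 - u -> 3 / 5 <= u <= 1 -> 0 < eta <= 1 ->
  g = n * (2 - u) + (D1 + G) -> 0 <= n -> n <= g -> 0 <= G -> G <= eta * n ->
  0 <= rest -> rest <= G * (2 * g) ->
  `|D1| <= eta * n -> `|D2| <= eta * n ->
  `|n * (n + 1) / 2 + ((n + 1) * (D2 + (1 - u) * n / 2) + (n + 1) *
    (D1 + (1 - u) * n)) + rest - g * (g + 1) / 2 - u / 10 * g ^+ 2| <=
  10 * eta * g ^+ 2 + 4 * g.
Proof.
move=> u_sq /andP[vl vu] /andP[eta0 eta1] gE n0 ng G0 G_le rest0 rest_le hD1 hD2.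
set theta := D1 + G in gE.
have en : eta * n <= eta * g by rewrite ler_wpM2l// ltW.
have nn : eta * n * n <= eta * g ^+ 2.
  by rewrite -mulrA expr2 ler_wpM2l ?(ltW eta0)// ler_pM.
have g0 : 0 <= g by exact: le_trans ng.
have en_n : eta * n <= n by rewrite ler_piMl.
have theta_le : `|theta| <= 2 * (eta * n).
  rewrite /theta; apply: (le_trans (ler_normD _ _)).
  by rewrite (ger0_norm G0) mulr_natl mulr2n lerD.
have E : n * (n + 1) / 2 + ((n + 1) * (D2 + (1 - u) * n / 2) + (n + 1) *
    (D1 + (1 - u) * n)) + rest - g * (g + 1) / 2 - u / 10 * g ^+ 2 =
  n * ((4 - 3 * u) / 2) + (n + 1) * (D1 + D2) + rest
    - (9 / 5 - 2 / 5 * u) * (n * theta) - (u / 10 + 1 / 2) * theta ^+ 2 - g / 2.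
  have z : u ^+ 2 + u - 1 = 0 by rewrite u_sq; ring.
  have gg : (u / 10 + 1 / 2) * g ^+ 2 = n ^+ 2 * (2 - 3 / 2 * u)
      + (9 / 5 - 2 / 5 * u) * (n * theta) + (u / 10 + 1 / 2) * theta ^+ 2.
    have -> : (u / 10 + 1 / 2) * g ^+ 2 = n ^+ 2 * (2 - 3 / 2 * u)
      + (9 / 5 - 2 / 5 * u) * (n * theta) + (u / 10 + 1 / 2) * theta ^+ 2
      + (u ^+ 2 + u - 1) * (n ^+ 2 * u / 10 - n * theta / 5) by rewrite gE; field.
    by rewrite z mul0r addr0.
  have -> : g * (g + 1) / 2 = (u / 10 + 1 / 2) * g ^+ 2 - u / 10 * g ^+ 2 + g / 2.
    by field.
  by rewrite gg /theta; field.
rewrite E.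
have T1 : `|(n + 1) * (D1 + D2)| <= 2 * (eta * g ^+ 2) + 2 * g.
  rewrite normrM ger0_norm ?addr_ge0//.
  apply: (@le_trans _ _ ((n + 1) * (2 * (eta * n)))).
    rewrite ler_wpM2l ?addr_ge0//; apply: (le_trans (ler_normD _ _)).
    by rewrite mulr_natl mulr2n lerD.
  have -> : (n + 1) * (2 * (eta * n)) = 2 * (eta * n * n) + 2 * (eta * n) by ring.
  by clear -nn en en_n ng; lra.
have T2 : `|n * theta| <= 2 * (eta * g ^+ 2).
  rewrite normrM (ger0_norm n0); apply: le_trans (ler_wpM2l n0 theta_le) _.
  have -> : n * (2 * (eta * n)) = 2 * (eta * n * n) by ring.
  by clear -nn; lra.
have T2' : `|(9 / 5 - 2 / 5 * u) * (n * theta)| <= 8 / 5 * (2 * (eta * g ^+ 2)).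
  by rewrite normrM ler_pM// ger0_norm; clear -vl vu; lra.
have T3 : `|(u / 10 + 1 / 2) * theta ^+ 2| <= 3 / 5 * (4 * (eta * g ^+ 2)).
  rewrite normrM ler_pM//; first by rewrite ger0_norm; clear -vl vu; lra.
  rewrite normrX; apply: (@le_trans _ _ ((2 * (eta * n)) ^+ 2)).
    by rewrite lerXn2r ?nnegrE// (le_trans _ theta_le).
  have -> : (2 * (eta * n)) ^+ 2 = 4 * (eta * (eta * n * n)) by ring.
  rewrite ler_wpM2l//; apply: (@le_trans _ _ (eta * n * n)); last by clear -nn; lra.
  by rewrite ler_piMl// mulr_ge0// mulr_ge0// ltW.
have T4 : rest <= 2 * (eta * g ^+ 2).
  apply: (le_trans rest_le); have -> : 2 * (eta * g ^+ 2) = eta * g * (2 * g) by ring.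
  by rewrite ler_wpM2r ?mulr_ge0//; clear -G_le en; lra.
have T5 : 0 <= n * ((4 - 3 * u) / 2) <= 11 / 10 * g.
  rewrite mulr_ge0//=; last by clear -vl vu; lra.
  apply: (@le_trans _ _ (n * (11 / 10))); last by clear -ng; lra.
  by rewrite ler_wpM2l//; clear -vl; lra.
have [T50 T51] := andP T5.
move: T1 T2' T3; rewrite !ler_norml => /andP[a1 a2] /andP[b1 b2] /andP[c1 c2].
have eg : 0 <= eta * g ^+ 2 by rewrite mulr_ge0 ?sqr_ge0// ltW.
rewrite -[10 * eta * _]mulrA.
set eg2 := eta * g ^+ 2 in nn eg T4 a1 a2 b1 b2 c1 c2 *.
clear -rest0 T4 T50 T51 a1 a2 b1 b2 c1 c2 eg g0.
move: ((n + 1) * (D1 + D2)) (_ * (n * theta)) (_ * theta ^+ 2) (n * _) eg2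
  rest0 T4 T50 T51 a1 a2 b1 b2 c1 c2 eg.
clear n D1 D2 theta u eta => t1 t2 t3 t5 t6 *.
by apply/andP; split; lra.
Qed.

Section WeightEstimate.
Variables (R : realType) (u : R).
Hypotheses (u_sq : u ^+ 2 = 1 - u) (u_lb : 618 / 1000 < u)
  (u_ub : u < 6181 / 10000).

Lemma sum_ordS n : (\sum_(i < n) i.+1 * 2 = n * n.+1)%N.
Proof.
elim: n => [|n IH]; first by rewrite big_ord0.
by rewrite big_ord_recr/= IH; clear; nia.
Qed.

Lemma sum_ord_leq2 (k : nat) (f : nat -> nat) : (0 < k)%N ->
  (\sum_(j < k) f j = f 0 + (1 < k) * f 1 + \sum_(j < k - 2) f j.+2)%N.
Proof.
case: k => // -[|k] _.
  by rewrite big_ord_recl big_ord0 mul0n (_ : 1 - 2 = 0)%N// big_ord0 !addn0.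
by rewrite !big_ord_recl mul1n addnA subn2.
Qed.

Section GapSums.
Variables (g n : nat) (H : {fset nat}).
Hypotheses (HN : NS g H) (Hm : multiplicity_of n.+1 H).
Let k := kunz_vector g n H.
Let big i := (1 < k i)%N.
Let k_gt0 i : (0 < k i)%N. Proof. exact: kunz_vector_gt0. Qed.

Lemma gaps_above_double : gaps_above H (2 * n.+1) = (\sum_(i < n) (k i - 2))%N.
Proof.
have := gaps_above_vector HN Hm (q := 2) (x := 0) (leq0n n) isT.
by rewrite addn0.
Qed.

Lemma genus_split : g = (n + \sum_(i < n) big i + gaps_above H (2 * n.+1))%N.
Proof.
rewrite gaps_above_double -{1}(sum_kunz_vector HN Hm) -/k.
transitivity (\sum_(i < n) 1 + \sum_(i < n) big i + \sum_(i < n) (k i - 2))%N;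
  last by rewrite sum_nat_const card_ord muln1.
rewrite -!big_split/=; apply: eq_bigr => i _.
by have := k_gt0 i; rewrite /big; case: (k i : nat) => // -[|j] _ /=; clear; lia.
Qed.

(** The first two rows of each column give the main term; [rest] collects the gaps above twice the
    multiplicity, each below [2 * g]. *)
Lemma sum_gaps_split : exists2 rest : nat,
  (rest <= gaps_above H (2 * n.+1) * (2 * g))%N &
  (\sum_(x <- H) x = \sum_(i < n) i.+1 + \sum_(i < n) big i * (i.+1 + n.+1) + rest)%N.
Proof.
exists (\sum_(i < n) \sum_(j < k i - 2) (i.+1 + j.+2 * n.+1))%N.
  rewrite gaps_above_double big_distrl/=; apply: leq_sum => i _.
  apply: (@leq_trans (\sum_(j < k i - 2) 2 * g)%N); last by rewrite sum_nat_const card_ord.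
  apply: leq_sum => j _.
  have [H0 HD gH] := NS_gaps HN; have [_ mH _] := Hm.
  have gap : (i.+1 + j.+2 * n.+1)%N \in H.
    by rewrite mem_kunz// -(kunz_vectorE HN Hm) -/k; have := ltn_ord j; clear; lia.
  by have := gap_lt HD gap; rewrite gH => /ltnW.
rewrite (sum_gaps_vector HN Hm (fun x => x)) -!big_split/=; apply: eq_bigr => i _.
by rewrite (sum_ord_leq2 (fun j => i.+1 + j * n.+1)%N (k_gt0 i)) mul0n addn0 mul1n.
Qed.

End GapSums.

Lemma sum_gaps_le g H : NS g H -> (\sum_(x <- H) x <= g * (2 * g))%N.
Proof.
move=> HN; have [H0 HD gH] := NS_gaps HN.
apply: (@leq_trans (\sum_(x <- H) 2 * g)%N).
  by rewrite !big_seq; apply: leq_sum => x xH; rewrite -gH ltnW// gap_lt.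
by rewrite big_const_seq count_predT iter_addn_0 gH mulnC.
Qed.

Lemma weightE g H : NS g H ->
  weight R H = (\sum_(x <- H) x)%N%:R - g%:R * (g%:R + 1) / 2.
Proof. by move=> [_ gH]; rewrite /weight gH natrM natr1. Qed.

(** A crude bound that controls the contribution of the atypical semigroups to the expectation. *)
Lemma weight_le g H : NS g H -> (0 < g)%N ->
  `|weight R H - u / 10 * g%:R ^+ 2| <= 4 * g%:R ^+ 2.
Proof.
move=> HN g0; have [v0 v1] : 0 <= u /\ u <= 1 by move: u_lb u_ub; split; lra.
rewrite (weightE HN); have := sum_gaps_le HN.
rewrite -(ler_nat R) !natrM; move: (ler0n R (\sum_(x <- H) x)).
set W := (\sum_(x <- H) x)%N%:R; have g1 : 1 <= g%:R :> R by rewrite ler1n.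
move: g1 v0 v1; move: (g%:R : R) W (u) => G W v G1 v0 v1 W0 W1.
have G2 : G <= G ^+ 2 by rewrite expr2 ler_peMl// (le_trans ler01).
have vG0 : 0 <= v * G ^+ 2 by rewrite mulr_ge0 ?sqr_ge0.
have vG1 : v * G ^+ 2 <= G ^+ 2 by rewrite ler_piMl ?sqr_ge0.
rewrite ler_norml; rewrite expr2 in G2 vG0 vG1 *.
by apply/andP; split; lra.
Qed.

(** Divided by the multiplicity so that the Chernoff bound, stated for weights of absolute value at
    most 1, applies. *)
Definition first_moment (n : nat) (i : 'I_n) : R := i.+1%:R / n.+1%:R.

(** The deviation with constant weights controls the number of gaps in the second row, and hence m /
    g; the one with [first_moment] controls the sum of their residues. *)
Lemma weight_close (eta : R) (P g n : nat) H : NS g H -> multiplicity_of n.+1 H ->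
  0 < eta <= 1 -> 1 <= eta * P%:R -> (P * gaps_above H (2 * n.+1) <= n)%N ->
  `|deviation u g (fun _ : 'I_n => 1) H| <= eta * n%:R ->
  `|deviation u g (@first_moment n) H| <= eta * n%:R ->
  `|weight R H - u / 10 * g%:R ^+ 2| <= 10 * eta * g%:R ^+ 2 + 4 * g%:R.
Proof.
move=> HN Hm eta01 etaP PG; have [eta0 eta1] := andP eta01.
rewrite (weightE HN).
have [rest restG ->] := sum_gaps_split HN Hm.
have gE := genus_split HN Hm.
set big := fun i => (1 < kunz_vector g n H i)%N in gE *.
set G := gaps_above H _ in restG gE PG.
set D1 := deviation _ _ _ _; set D2 := deviation _ _ _ _ => hD1 hD2.
have D1E : (\sum_(i < n) big i)%N%:R = D1 + (1 - u) * n%:R.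
  rewrite /D1 /deviation natr_sum.
  under [in RHS]eq_bigr do rewrite mul1r.
  by rewrite sumrB sumr_const card_ord u_sq mulr_natr subrK.
have SE : (\sum_(i < n) i.+1)%N%:R = n%:R * n.+1%:R / 2 :> R.
  by rewrite -natrM -sum_ordS -big_distrl/= natrM mulfK.
have m0 : n.+1%:R != 0 :> R by rewrite pnatr_eq0.
have D2E : (\sum_(i < n) big i * i.+1)%N%:R = n.+1%:R * (D2 + (1 - u) * n%:R / 2).
  have -> : D2 = (\sum_(i < n) big i * i.+1)%N%:R / n.+1%:R - (1 - u) * n%:R / 2.
    rewrite /D2 /deviation natr_sum.
    rewrite (eq_bigr (fun i : 'I_n => (big i * i.+1)%N%:R / n.+1%:R -
      (1 - u) / n.+1%:R * i.+1%:R)) => [|i _].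
      have SE' : \sum_(i < n) i.+1%:R = n%:R * n.+1%:R / 2 :> R by rewrite -natr_sum.
      rewrite sumrB -mulr_suml -mulr_sumr SE'.
      by congr (_ - _); move: m0; move: n.+1%:R => m m0; field.
    by rewrite /first_moment -/(big i) natrM u_sq; move: m0; move: n.+1%:R => m m0; field.
  by rewrite subrK mulrC divfK.
have -> : (\sum_(i < n) big i * (i.+1 + n.+1))%N =
    (\sum_(i < n) big i * i.+1 + n.+1 * \sum_(i < n) big i)%N.
  rewrite big_distrr/= -big_split; apply: eq_bigr => i _ /=.
  by rewrite mulnDr [(n.+1 * _)%N]mulnC.
have castE (a b c d : nat) : (a + (b + n.+1 * c) + d)%N%:R =
    a%:R + (b%:R + n.+1%:R * c%:R) + d%:R :> R by rewrite -natrM -!natrD.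
rewrite castE D1E D2E SE.
have gR : g%:R = n%:R * (2 - u) + (D1 + G%:R) :> R.
  by rewrite {1}gE !natrD D1E; ring.
have ng : n%:R <= g%:R :> R by rewrite ler_nat gE -addnA leq_addr.
have G_le : G%:R <= eta * n%:R :> R.
  have : (P * G)%N%:R <= n%:R :> R by rewrite ler_nat.
  move=> PGR; apply: le_trans (ler_wpM2l (ltW eta0) PGR).
  by rewrite natrM mulrA ler_peMl.
have rest_le : rest%:R <= G%:R * (2 * g%:R) :> R by rewrite -!natrM ler_nat.
have n0 : 0 <= n%:R :> R by [].
have G0 : 0 <= G%:R :> R by [].
have rest0 : 0 <= rest%:R :> R by [].
rewrite -(natr1 n).
apply: (@weight_error_bound _ _ eta _ _ D1 D2 G%:R rest%:R) => //.
by move: u_lb u_ub; lra.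
Qed.

End WeightEstimate.

(** * Semigroups of atypical weight *)

Section BadSemigroups.
Variables (R : realType) (u : R).
Hypotheses (u_sq : u ^+ 2 = 1 - u) (u_lb : 618 / 1000 < u)
  (u_ub : u < 6181 / 10000).
Let u_gt0 : 0 < u. Proof. by move: u_lb; lra. Qed.

Definition bad (eps : R) (g : nat) (H : {fset nat}) : Prop :=
  eps * g%:R ^+ 2 <= `|weight R H - u / 10 * g%:R ^+ 2|.

(** The sign [b] turns the one-sided Chernoff bound into a two-sided one; [c] selects which of the
    two statistics is tested. *)
Definition tilt (n : nat) (b c : bool) (i : 'I_n) : R :=
  (-1) ^+ b * (if c then 1 else @first_moment R n i).

Lemma tilt_le1 n b c (i : 'I_n) : `|tilt b c i| <= 1.
Proof.
rewrite /tilt normrM normrX normrN1 expr1n mul1r; case: c; first by rewrite normr1.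
rewrite /first_moment ger0_norm ?divr_ge0// ler_pdivrMr// mul1r ler_nat.
exact: leqW.
Qed.

Lemma deviation_tilt g n b c H : deviation u g (@tilt n b c) H =
  (-1) ^+ b * deviation u g (fun i => if c then 1 else @first_moment R n i) H.
Proof. by rewrite /deviation mulr_sumr; apply: eq_bigr => i _; rewrite mulrA. Qed.

(** The two numerical hypotheses on [eps] make each term of the error 10 eta g^2 + 4 g at most half
    of eps g^2. *)
Lemma bad_cases (eps eta : R) (P g n : nat) H : NS g H -> multiplicity_of n.+1 H ->
  0 < eta <= 1 -> 1 <= eta * P%:R -> 20 * eta <= eps -> 8 < eps * g%:R ->
  bad eps g H ->
  (n < P * gaps_above H (2 * n.+1))%N \/
  ((P * gaps_above H (2 * n.+1) <= n)%N /\
   exists b c, eta * n%:R <= deviation u g (@tilt n b c) H).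
Proof.
move=> HN Hm eta01 etaP eta_eps g_eps; rewrite /bad => Hbad.
have [|PG] := ltnP n (P * gaps_above H (2 * n.+1)); [by left|right; split=> //].
apply: contrapT => no_dev.
have small c : `|deviation u g (fun i => if c then 1 else @first_moment R n i) H| <= eta * n%:R.
  rewrite leNgt; apply/negP => /ltW; rewrite ler_normr => /orP[le|le]; apply: no_dev.
    by exists false, c; rewrite deviation_tilt expr0 mul1r.
  by exists true, c; rewrite deviation_tilt expr1 mulN1r.
have := weight_close u_sq u_lb u_ub HN Hm eta01 etaP PG (small true) (small false).
rewrite leNgt => /negP; apply; apply: lt_le_trans Hbad.
have g0 : 0 < g%:R :> R.
  rewrite ltr0n lt0n; apply/eqP => g0; move: g_eps.
  by rewrite g0 mulr0 ltNge ler0n.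
have gg : 8 * g%:R < eps * g%:R ^+ 2 by rewrite expr2 mulrA ltr_pM2r.
have ee : 20 * eta * g%:R ^+ 2 <= eps * g%:R ^+ 2 by rewrite ler_wpM2r ?sqr_ge0.
by move: gg ee; lra.
Qed.

Lemma count_bad_multiplicity (eps : R) : 0 < eps ->
  exists C tau : R, exists g0 : nat, [/\ 0 < C, 0 < tau &
  forall g n : nat, (g0 <= g)%N ->
    u ^+ g * count_semigroups R g (fun H => multiplicity_of n.+1 H /\ bad eps g H)
    <= C * g.+1%:R * expR (- (tau * g%:R))].
Proof.
move=> eps0; pose eta : R := Num.min 1 (eps / 20).
have eta01 : 0 < eta <= 1 by rewrite lt_min ltr01 divr_gt0// ge_min lexx.
have [eta0 eta1] := andP eta01.
have eta_eps : 20 * eta <= eps.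
  by rewrite mulrC -ler_pdivlMr// ge_min lexx orbT.
have [tau1 t10 small] := small_multiplicity_decay u_lb u_ub.
have [P0 [tau2 t20 dev]] := deviation_decay u_sq u_lb u_ub eta01.
pose P := (P0 + (Num.bound eta^-1).+1)%N.
have etaP : 1 <= eta * P%:R.
  rewrite mulrC -ler_pdivrMr// mul1r.
  apply: (@le_trans _ _ (Num.bound eta^-1)%:R).
    by apply/ltW/archi_boundP; rewrite invr_ge0 ltW.
  by rewrite ler_nat /P addnS leqW// leq_addl.
have P_gt0 : (0 < P)%N by rewrite /P addnS.
have [C3 [tau3 [n0 [C30 t30 many]]]] := many_gaps_decay u_sq u_lb u_ub P_gt0.
(* The last two rates are per unit of n; they are used when g < 10 (n + 1), hence the division by
   10. *)
pose tau := Num.min tau1 (Num.min (tau2 / 10) (tau3 / 10)).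
have tau0 : 0 < tau by rewrite !lt_min t10 !divr_gt0.
have tau_1 : tau <= tau1 by rewrite ge_min lexx.
have tau_2 : tau <= tau2 / 10 by rewrite !ge_min lexx orbT.
have tau_3 : tau <= tau3 / 10 by rewrite !ge_min lexx !orbT.
pose C2 := expR tau2 + 2 * C3 * expR tau3.
have C20 : 0 < C2 by rewrite addr_gt0 ?mulr_gt0 ?expR_gt0.
exists (1 + 5 * C2), tau, (10 * n0.+1 + (Num.bound (8 / eps)))%N.
split=> // [|g n gg]; first by rewrite addr_gt0// mulr_gt0.
have g_eps : 8 < eps * g%:R.
  rewrite mulrC -ltr_pdivrMr//; apply: lt_le_trans (_ : (Num.bound (8 / eps))%:R <= _).
    by apply: archi_boundP; rewrite divr_ge0// ltW.
  by rewrite ler_nat (leq_trans _ gg)// leq_addl.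
have g1 : 1 <= g.+1%:R :> R by rewrite ler1n.
have [ng|ng] := leqP (10 * n.+1) g.
  apply: (@le_trans _ _ (expR (- (tau1 * g%:R)))).
    apply: le_trans (small g n ng); rewrite ler_wpM2l ?exprn_ge0 ?(ltW u_gt0)//.
    by apply: ler_count_semigroups => H _ [].
  apply: (@le_trans _ _ (expR (- (tau * g%:R)))).
    by rewrite ler_expR lerN2 ler_wpM2r.
  rewrite ler_peMl ?expR_ge0// mulr_ege1// lerDl mulr_ge0// ltW//.
have n0n : (n0 <= n)%N by move: gg ng; clear; lia.
have gn : (g <= 10 * n.+1)%N by exact: ltnW.
have decay (t : R) : 0 < t -> tau <= t / 10 ->
    expR (- (t * n%:R)) <= expR t * expR (- (tau * g%:R)).
  move=> t0 tt; rewrite -expRD ler_expR.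
  have gR : g%:R <= 10 * (n%:R + 1) :> R by rewrite natr1 -natrM ler_nat.
  have := ler_pM (ltW tau0) (ler0n R g) tt gR.
  have -> : t / 10 * (10 * (n%:R + 1)) = t * n%:R + t by field.
  lra.
pose X := C2 * g.+1%:R * expR (- (tau * g%:R)).
have X0 : 0 <= X by rewrite !mulr_ge0 ?expR_ge0// ltW.
(* Four deviations and the case of many gaps: five events, whence the factor 5 in the constant. *)
pose Q (o : option (bool * bool)) (H : {fset nat}) : Prop :=
  if o is Some (b, c) then multiplicity_of n.+1 H /\
    ((P * gaps_above H (2 * n.+1) <= n)%N /\ eta * n%:R <= deviation u g (@tilt n b c) H)
  else multiplicity_of n.+1 H /\ (n < P * gaps_above H (2 * n.+1))%N.
apply: (@le_trans _ _ (u ^+ g * \sum_o count_semigroups R g (Q o))).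
  rewrite ler_wpM2l ?exprn_ge0 ?(ltW u_gt0)//; apply: count_semigroups_bigcup.
  move=> H HN [Hm Hbad].
  have [?|[? [b [c ?]]]] := bad_cases HN Hm eta01 etaP eta_eps g_eps Hbad.
    by exists None.
  by exists (Some (b, c)).
rewrite mulr_sumr; apply: (@le_trans _ _ (\sum_(o : option (bool * bool)) X)).
  apply: ler_sum => -[[b c]|] _ /=.
    apply: (le_trans (dev P g n _ (leq_addr _ _) P_gt0 (@tilt_le1 n b c))).
    apply: (le_trans (decay _ t20 tau_2)); rewrite /X ler_wpM2r ?expR_ge0//.
    apply: (@le_trans _ _ C2); last by rewrite ler_peMr// ltW.
    by rewrite lerDl !mulr_ge0 ?expR_ge0// ltW.
  apply: (le_trans (many g n n0n gn)).
  apply: (@le_trans _ _ (C3 * (2 * g).+1%:R * (expR tau3 * expR (- (tau * g%:R))))).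
    by rewrite ler_wpM2l ?decay// mulr_ge0// ltW.
  rewrite mulrA /X ler_wpM2r ?expR_ge0//.
  apply: (@le_trans _ _ (2 * C3 * expR tau3 * g.+1%:R)).
    rewrite [leRHS]mulrAC ler_wpM2r ?expR_ge0// [2 * C3]mulrC -mulrA.
    by rewrite ler_wpM2l ?(ltW C30)// -natrM ler_nat; clear; lia.
  by rewrite ler_wpM2r// lerDr expR_ge0.
rewrite sumr_const card_option card_prod card_bool -[leLHS]mulr_natl /X.
rewrite !mulrA ler_wpM2r ?expR_ge0// ler_wpM2r//.
by rewrite lerDr.
Qed.

Lemma bad_fraction (eps delta : R) : 0 < eps -> 0 < delta ->
  exists g0 : nat, forall g, (g0 <= g)%N ->
    count_semigroups R g (bad eps g) <= delta * #|` semigroups g|%:R.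
Proof.
move=> eps0 delta0.
have [C [tau [g1 [C0 tau0 Cbad]]]] := count_bad_multiplicity eps0.
have u1 : u < 1 by move: u_ub; lra.
(* Two uses of z <= exp z absorb the polynomial factor; a third one gives the
   decay. *)
pose a := tau / 4; have a0 : 0 < a by rewrite divr_gt0.
pose B := C * expR (2 * a) / (a ^+ 2 * (u * (delta * (2 * a)))).
have B0 : 0 < B.
  by rewrite /B divr_gt0 ?mulr_gt0 ?expR_gt0 ?exprn_gt0 ?mulr_gt0.
exists (g1 + (Num.bound B).+1)%N => g gg.
have g1g : (g1 <= g)%N by rewrite (leq_trans _ gg)// leq_addr.
have Bg : B <= g%:R.
  apply: (@le_trans _ _ (Num.bound B)%:R); first by apply/ltW/archi_boundP/ltW.
  by rewrite ler_nat (leq_trans _ gg)// addnS leqW// leq_addl.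
have total : u ^+ g * count_semigroups R g (bad eps g) <=
    g.+1%:R * (C * g.+1%:R * expR (- (tau * g%:R))).
  apply: (@le_trans _ _ (u ^+ g * \sum_(n < g.+1) count_semigroups R g
      (fun H => multiplicity_of n.+1 H /\ bad eps g H))).
    rewrite ler_wpM2l ?exprn_ge0 ?(ltW u_gt0)//; apply: count_semigroups_bigcup.
    move=> H HN Hbad; have [m mg Hm] := multiplicity_exists H.
    have [_ _ gH] := NS_gaps HN; rewrite gH in mg.
    have m0 : (0 < m)%N by case: Hm.
    have mg' : (m.-1 < g.+1)%N by rewrite (prednK m0).
    by exists (Ordinal mg'); rewrite /= prednK.
  rewrite mulr_sumr mulr_natl -[X in _ <= _ *+ X]card_ord -sumr_const.
  by apply: ler_sum => n _; exact: Cbad.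
have z_le (z : R) : z <= expR z by apply: le_trans (expR_ge1Dx z); rewrite lerDr.
have poly : a * g.+1%:R <= expR (a * g.+1%:R) by exact: z_le.
have poly2 : (a * g.+1%:R) ^+ 2 <= expR (2 * a) * expR (2 * a * g%:R).
  apply: (@le_trans _ _ (expR (a * g.+1%:R) ^+ 2)).
    by rewrite lerXn2r ?nnegrE ?expR_ge0// mulr_ge0// ltW.
  by rewrite -expRM_natl -expRD ler_expR -natr1; lra.
have lower := card_semigroups_ge u_sq u_gt0 u1 g.
have decay : 2 * a * g%:R * expR (- (2 * a * g%:R)) <= 1.
  apply: (@le_trans _ _ (expR (2 * a * g%:R) * expR (- (2 * a * g%:R)))).
    by rewrite ler_wpM2r ?expR_ge0.
  by rewrite -expRD subrr expR0.
have ug : 0 < u ^+ g by rewrite exprn_gt0.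
rewrite -(ler_pM2l ug); apply: (le_trans total).
have tauE : tau * g%:R = 2 * a * g%:R + 2 * a * g%:R by rewrite /a; field.
rewrite tauE opprD expRD.
set E := expR (- _) in decay *; have E0 : 0 < E by exact: expR_gt0.
have EE : expR (2 * a * g%:R) * E = 1 by rewrite /E -expRD subrr expR0.
have step1 : (a * g.+1%:R) ^+ 2 * E <= expR (2 * a).
  have -> : expR (2 * a) = expR (2 * a) * expR (2 * a * g%:R) * E.
    by rewrite -mulrA EE mulr1.
  by rewrite ler_wpM2r// ltW.
have a2 : 0 < a ^+ 2 by rewrite exprn_gt0.
(* The Fibonacci lower bound reduces the goal to a comparison with the constant [delta * u]. *)
apply: (@le_trans _ _ (delta * u)); last first.
  by rewrite mulrCA ler_wpM2l ?(ltW delta0)// mulrC.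
have -> : g.+1%:R * (C * g.+1%:R * (E * E)) =
    C / a ^+ 2 * ((a * g.+1%:R) ^+ 2 * E) * E.
  by field; rewrite gt_eqF.
apply: (@le_trans _ _ (C / a ^+ 2 * expR (2 * a) * E)).
  by rewrite ler_wpM2r ?(ltW E0)// ler_wpM2l// divr_ge0 ?(ltW C0) ?(ltW a2).
have -> : C / a ^+ 2 * expR (2 * a) = B * (2 * a) * (delta * u).
  by rewrite /B; field; rewrite !gt_eqF.
rewrite mulrAC ler_piMl ?mulr_ge0 ?(ltW delta0) ?(ltW u_gt0)//.
apply: le_trans decay; rewrite ler_wpM2r ?(ltW E0)// mulrC ler_wpM2l//.
by rewrite mulr_ge0// ltW.
Qed.

End BadSemigroups.

(** * The inverse of the golden ratio *)

Section GoldenRatio.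
Variable R : realType.

Definition inv_golden : R := (Num.sqrt 5 - 1) / 2.

Let sqrt5_sq : (Num.sqrt 5 : R) ^+ 2 = 5.
Proof. by rewrite sqr_sqrtr// ler0n. Qed.

Let sqrt5_ge0 : 0 <= (Num.sqrt 5 : R).
Proof. exact: sqrtr_ge0. Qed.

Lemma inv_golden_sq : inv_golden ^+ 2 = 1 - inv_golden.
Proof. by rewrite /inv_golden expr_div_n sqrrB sqrt5_sq mulr1 expr1n; field. Qed.

Lemma inv_golden_lb : 618 / 1000 < inv_golden.
Proof.
have lt : 2236 / 1000 < (Num.sqrt 5 : R).
  rewrite ltNge; apply/negP => le; have := ler_pM sqrt5_ge0 sqrt5_ge0 le le.
  by rewrite -[leLHS]expr2 sqrt5_sq; lra.
by rewrite /inv_golden; lra.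
Qed.

Lemma inv_golden_ub : inv_golden < 6181 / 10000.
Proof.
have lt : (Num.sqrt 5 : R) < 22362 / 10000.
  have c0 : 0 <= 22362 / 10000 :> R by lra.
  rewrite ltNge; apply/negP => le; have := ler_pM c0 c0 le le.
  by rewrite -[leRHS]expr2 sqrt5_sq; lra.
by rewrite /inv_golden; lra.
Qed.

Lemma inv_10_golden : (10 * golden R)^-1 = inv_golden / 10.
Proof.
rewrite /golden /inv_golden.
have s1 : (1 + Num.sqrt 5 : R) != 0 by rewrite gt_eqF// ltr_pwDl.
have : (Num.sqrt 5 : R) ^+ 2 = 5 by [].
move: s1; move: (Num.sqrt 5 : R) => s s1 ss.
have -> : (s - 1) / 2 / 10 = (s ^+ 2 - 1) / (20 * (1 + s)) by field.
by rewrite ss; field.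
Qed.

End GoldenRatio.

(** * From counts to probabilities and expectations *)

Section Statistics.
Variable R : realType.

Lemma sum_NS g (F : {fset nat} -> R) :
  \sum_(H \in NS g) F H = \sum_(H <- semigroups g) F H.
Proof. exact/fsbig_finite/finite_NS. Qed.

Lemma card_NSE g : card_NS R g = #|` semigroups g|%:R.
Proof.
by rewrite /card_NS sum_NS big_const_seq count_predT iter_addr_0.
Qed.

Lemma sum_semigroups_cst g (c : R) : \sum_(H <- semigroups g) c = card_NS R g * c.
Proof. by rewrite card_NSE big_const_seq count_predT iter_addr_0 mulr_natl. Qed.

Lemma card_NS_gt0 g : 0 < card_NS R g.
Proof.
rewrite card_NSE lt_def ler0n andbT; apply/negP => /eqP card0.
have u0 : 0 < inv_golden R by have := inv_golden_lb R; lra.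
have u1 : inv_golden R < 1 by have := inv_golden_ub R; lra.
have := card_semigroups_ge (inv_golden_sq R) u0 u1 g.
by rewrite card0 mul0r leNgt u0.
Qed.

Lemma Prob_gE g (A : {fset nat} -> Prop) :
  Prob_g R g A = count_semigroups R g A / card_NS R g.
Proof.
rewrite /Prob_g fsbig_mkcondr sum_NS; congr (_ / _).
rewrite /count_semigroups; apply: eq_bigr => H _.
have -> : (H \in (A : set {fset nat})) = `[< A H >].
  by apply/idP/asboolP => [/set_mem|/mem_set].
by case: asboolP.
Qed.

Lemma Prob_gC g (A B : {fset nat} -> Prop) : (forall H, B H <-> ~ A H) ->
  Prob_g R g A = 1 - Prob_g R g B.
Proof.
move=> AB; rewrite !Prob_gE -[X in X - _](divff (lt0r_neq0 (card_NS_gt0 g))) -mulrBl.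
congr (_ / _); rewrite {1}/card_NS sum_NS /count_semigroups -sumrB.
apply: eq_bigr => H _; case: asboolP => HA; case: asboolP => HB; rewrite ?subrr ?subr0//.
  by case: ((AB H).1 HB).
by exfalso; apply: HB; apply/AB.
Qed.

Local Notation u := (inv_golden R).

Lemma Prob_bad_le (eps delta : R) : 0 < eps -> 0 < delta ->
  exists g0 : nat, forall g, (g0 <= g)%N -> Prob_g R g (bad u eps g) <= delta.
Proof.
move=> eps0 delta0.
have [g0 g0P] := bad_fraction (inv_golden_sq R) (inv_golden_lb R) (inv_golden_ub R)
  eps0 delta0.
exists g0 => g /g0P; rewrite Prob_gE ler_pdivrMr ?card_NS_gt0// card_NSE//.
Qed.

(** Each typical semigroup contributes an error below eps g^2, each atypical one at most 4 g^2 by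
    [weight_le]. *)
Lemma Exp_weight_close (eps : R) g : (0 < g)%N -> 0 < eps ->
  `|Exp_g g (@weight R) / g%:R ^+ 2 - u / 10| <= eps + 4 * Prob_g R g (bad u eps g).
Proof.
move=> g0 eps0; have card0 := card_NS_gt0 g.
have gR : 0 < g%:R :> R by rewrite ltr0n.
have gg : 0 < g%:R ^+ 2 :> R by rewrite exprn_gt0.
have -> : Exp_g g (@weight R) / g%:R ^+ 2 - u / 10 =
    (\sum_(H <- semigroups g) (weight R H - u / 10 * g%:R ^+ 2)) /
    (card_NS R g * g%:R ^+ 2).
  rewrite sumrB sum_semigroups_cst /Exp_g sum_NS.
  by field; rewrite (gt_eqF card0) (gt_eqF gR).
rewrite normrM normfV (gtr0_norm (mulr_gt0 card0 gg)) ler_pdivrMr ?mulr_gt0//.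
rewrite Prob_gE mulrDl.
have -> : 4 * (count_semigroups R g (bad u eps g) / card_NS R g) *
    (card_NS R g * g%:R ^+ 2) =
    \sum_(H <- semigroups g) `[< bad u eps g H >]%:R * (4 * g%:R ^+ 2).
  rewrite -mulr_suml -/(count_semigroups R g (bad u eps g)).
  by field; rewrite (gt_eqF card0).
have -> : eps * (card_NS R g * g%:R ^+ 2) = \sum_(H <- semigroups g) eps * g%:R ^+ 2.
  by rewrite sum_semigroups_cst mulrCA.
rewrite -big_split/=; apply: (le_trans (ler_norm_sum _ _ _)).
rewrite !big_seq; apply: ler_sum => H /mem_semigroups HN.
have eg : 0 <= eps * g%:R ^+ 2 by rewrite mulr_ge0// ltW.
case: asboolP => [_|/negP]; last by rewrite -ltNge mul0r addr0 => /ltW.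
rewrite mul1r; apply: le_trans (weight_le (inv_golden_lb R) (inv_golden_ub R) HN g0) _.
by rewrite lerDr.
Qed.

End Statistics.

Theorem theorem1p7 (R : realType) :
  ((fun g : nat => Exp_g g (@weight R) / (g%:R ^+ 2)) @ \oo
     --> (10 * golden R)^-1)
  /\
  (forall eps : R, 0 < eps ->
     (fun g : nat =>
        Prob_g R g (fun H => `| weight R H - (10 * golden R)^-1 * g%:R ^+ 2 |
                             < eps * g%:R ^+ 2)) @ \oo --> (1 : R)).
Proof.
rewrite inv_10_golden; split=> [|eps eps0]; apply/cvgrPdist_le => /= e e0.
  (* The bound eps + 4 * probability becomes e / 2 + 4 (e / 8) = e. *)
  have e2 : 0 < e / 2 by rewrite divr_gt0.
  have e8 : 0 < e / 8 by rewrite divr_gt0.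
  have [g0 g0P] := Prob_bad_le e2 e8.
  exists g0.+1 => // g /= g0g; rewrite distrC.
  apply: (le_trans (Exp_weight_close (leq_ltn_trans (leq0n g0) g0g) e2)).
  by have := g0P g (ltnW g0g); lra.
have [g0 g0P] := Prob_bad_le eps0 e0.
exists g0 => // g /= g0g.
rewrite (@Prob_gC _ _ _ (bad (inv_golden R) eps g)) => [|H].
  rewrite subKr ger0_norm ?g0P// Prob_gE divr_ge0 ?count_semigroups_ge0//.
  exact/ltW/card_NS_gt0.
by rewrite /bad leNgt; split=> [/negP|/negP].
Qed.
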